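(* Induced Steiner Subgraph Enumeration restricted to claw-free input graphs can be solved with polynomial delay (using exponential space).
   Context: A graph is claw-free if it has no induced subgraph isomorphic to $K_{1,3}$. Induced Steiner Subgraph Enumeration: given an undirected graph $G=(V,E)$ and a terminal set $W\subseteq V$, output, each exactly once, all inclusion-minimal vertex sets $X\subseteq V$ such that $G[X]$ contains a path between every pair of vertices of $W$. Polynomial delay means that the time before the first output, between any two consecutive outputs, and after the last output is bounded by a polynomial in the input size. *)

(* Defs.v *)
From mathcomp Require Import all_boot all_order all_algebra.

Set Implicit Arguments.
Unset Strict Implicit.
Unset Printing Implicit Defensive.

(** * Graphs: symmetric irreflexive relations on a finite type *)

Definition simple_graph (T : finType) (e : rel T) : Prop :=
  symmetric e /\ irreflexive e.

Definition complete_bipartite (m n : nat) : rel ('I_m + 'I_n) :=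
  fun x y => match x, y with
             | inl _, inr _ | inr _, inl _ => true
             | _, _ => false
             end.

Definition has_induced (T1 T2 : finType) (e1 : rel T1) (e2 : rel T2) : Prop :=
  exists2 f : T1 -> T2, injective f & forall x y, e2 (f x) (f y) = e1 x y.

Definition claw_free (T : finType) (e : rel T) : Prop :=
  ~ has_induced (@complete_bipartite 1 3) e.

Definition induced (T : finType) (e : rel T) (X : {set T}) : rel T :=
  [rel x y | [&& x \in X, y \in X & e x y]].

(* [u] and [v] need not be distinct, so [W \subset X] even when [#|W| = 1]. *)
Definition connects (T : finType) (e : rel T) (W X : {set T}) : bool :=
  [forall u in W, forall v in W,
    [&& u \in X, v \in X & connect (induced e X) u v]].

Definition min_steiner (T : finType) (e : rel T) (W : {set T}) :
    {set {set T}} :=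
  [set X | minset (connects e W) X].

(** * Random access machines (Cook and Reckhow), logarithmic cost *)

(* [X_a] is the content of register [a].  The words printed since the last
   [Emit] form one output, which [Emit] delivers.  A machine halts when its
   program counter leaves the program. *)
Inductive instr : Type :=
  | Const of nat & nat          (* X_i <- c             *)
  | Add of nat & nat & nat      (* X_i <- X_j + X_k     *)
  | Sub of nat & nat & nat      (* X_i <- X_j - X_k, truncated at 0 *)
  | Fetch of nat & nat          (* X_i <- X_(X_j)       *)
  | Put of nat & nat            (* X_(X_i) <- X_j       *)
  | Jpos of nat & nat           (* if X_i > 0 goto l    *)
  | Read of nat                 (* X_i <- next input word, 0 if none is left *)
  | Print of nat                (* print X_i            *)
  | Emit.

Definition program := seq instr.

Record config : Type := Config {
  pc : nat;
  mem : nat -> nat;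
  inp : seq nat;
  buf : seq nat;
  outs : seq (nat * seq nat);   (* delivered outputs with their time stamps *)
  clock : nat
}.

Definition bitlen (m : nat) : nat := (trunc_log 2 m).+1.

Definition upd (m : nat -> nat) (a v : nat) : nat -> nat :=
  fun b => if b == a then v else m b.

Definition cost (i : instr) (c : config) : nat :=
  let X := mem c in
  match i with
  | Const _ v => bitlen v
  | Add _ j k | Sub _ j k => bitlen (X j) + bitlen (X k)
  | Fetch _ j => bitlen (X j) + bitlen (X (X j))
  | Put i j => bitlen (X i) + bitlen (X j)
  | Jpos i _ => bitlen (X i)
  | Read _ => bitlen (head 0 (inp c))
  | Print i => bitlen (X i)
  | Emit => 1
  end.

Definition exec (i : instr) (c : config) : config :=
  let: Config p X s b o t := c in
  let t' := t + cost i c in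
  match i with
  | Const i v => Config p.+1 (upd X i v) s b o t'
  | Add i j k => Config p.+1 (upd X i (X j + X k)) s b o t'
  | Sub i j k => Config p.+1 (upd X i (X j - X k)) s b o t'
  | Fetch i j => Config p.+1 (upd X i (X (X j))) s b o t'
  | Put i j => Config p.+1 (upd X (X i) (X j)) s b o t'
  | Jpos i l => Config (if 0 < X i then l else p.+1) X s b o t'
  | Read i => Config p.+1 (upd X i (head 0 s)) (behead s) b o t'
  | Print i => Config p.+1 X s (rcons b (X i)) o t'
  | Emit => Config p.+1 X s [::] (rcons o (t', b)) t'
  end.

Definition step (P : program) (c : config) : option config :=
  omap (fun i => exec i c) (onth P (pc c)).

Definition init (s : seq nat) : config := Config 0 (fun=> 0) s [::] [::] 0.

Definition reaches (P : program) (s : seq nat) (c : config) : Prop :=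
  exists k, iter k (obind (step P)) (Some (init s)) = Some c.

(* On input [s] the machine halts, its outputs are the words of [L], each
   delivered exactly as often as it occurs in [L], and at most [D] time passes
   before the first output, between consecutive outputs, and from the last
   output (or the start, if there is none) to halting. *)
Definition enumerates_with_delay
    (P : program) (s : seq nat) (L : seq (seq nat)) (D : nat) : Prop :=
  exists c, [/\ reaches P s c, step P c = None,
    perm_eq [seq o.2 | o <- outs c] L &
    path [rel t1 t2 | t2 <= t1 + D] 0 (rcons [seq o.1 | o <- outs c] (clock c))].

(* Space is the total bit length of the addresses and contents of the registers
   in use; [A] may be any list containing all nonzero registers. *)
Definition runs_in_space (P : program) (s : seq nat) (S : nat) : Prop :=
  forall c, reaches P s c ->
  exists2 A : seq nat, (forall a, mem c a != 0 -> a \in A) &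
    \sum_(a <- A) (bitlen a + bitlen (mem c a)) <= S.

(** * Encodings *)

(* Number of vertices, adjacency matrix, characteristic vector of [W]. *)
Definition encode_input (n : nat) (e : rel 'I_n) (W : {set 'I_n}) : seq nat :=
  n :: [seq nat_of_bool (e x y) | x <- enum 'I_n, y <- enum 'I_n]
    ++ [seq nat_of_bool (x \in W) | x <- enum 'I_n].

Definition input_size (s : seq nat) : nat := \sum_(w <- s) bitlen w.

Definition encode_set (n : nat) (X : {set 'I_n}) : seq nat :=
  [seq nat_of_ord x | x <- enum X].

(* Main.v *)
Require Import Defs.
From mathcomp Require Import all_boot all_order all_algebra.
From mathcomp Require Import zify.

Set Implicit Arguments.
Unset Strict Implicit.
Unset Printing Implicit Defensive.

(** Fix a terminal [r].  In a minimal solution [X] of a claw-free graph, deleting a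
    nonterminal leaves exactly two components, and the neighbours of the deleted
    vertex in each of them form a clique.  For vertices [v] and [w] let [C] be the
    component of [r] in [X :\ v], and let [Z] consist of [w] and of all vertices that
    are not in the open neighbourhood of [C].  If [Z] connects the terminals, greedy
    deletion turns it into a minimal solution, a neighbour of [X].

    Every solution [Y] is reachable from every [X] by such moves: grow a connected
    subset [D] of [Y] from [r], one vertex at a time, depth first and taking adjacent
    terminals eagerly.  If [X] contains [D] but not the next vertex [w], then some [v]
    in [X] next to [D] has the property that [Z] connects the terminals while neither
    [w] nor any vertex of [D] can be deleted from [Z].

    Hence a traversal of the polynomially many neighbours of each solution finds them
    all.  The machine uses the bit vector of a solution as the address of its entry in
    the table of visited solutions, and this entry is also its link in the stack of
    unprocessed ones. *)

(** * Minimal solutions of claw-free graphs *)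

(** The machine tries all pairs [(v, w)] without knowing a target [Y], and the outcome of greedy
    deletion cannot be steered. So the size of the common part of [X] and [Y] is no measure of
    progress; instead the prefix [D] must survive in every minimal solution inside [Z]. A vertex
    survives exactly if its removal from [Z] cuts a terminal off from [r]. This is why [Z] takes in
    everything that is not adjacent to [C]: it then contains the detour through [Y], while [w] stays
    the only gate between [C] and the rest, so that cuts of [X] carry over to [Z]. Eager terminals
    make the vertices of [X] next to [D] nonterminals; what they cut off is pairwise nonadjacent,
    and a detour that meets two such parts produces a claw.

    For the delay, a solution is printed when it is popped, before its neighbours are generated. An
    instruction at most doubles the largest content or address, so the cost of a round stays
    polynomial in the number of its instructions. Auxiliary variables and scratch registers are
    cleared in each round, so that this growth does not accumulate over exponentially many
    rounds. *)

Lemma claw_free_three (T : finType) (e : rel T) : simple_graph e -> claw_free e ->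
  forall c x y z, e c x -> e c y -> e c z ->
  x != y -> x != z -> y != z -> [|| e x y, e x z | e y z].
Proof.
move=> [symE irrE] cf c x y z cx cy cz xy xz yz; apply/negPn/negP => /norP[nxy /norP[nxz nyz]].
apply: cf; pose f (i : 'I_1 + 'I_3) := match i with
  | inl _ => c
  | inr j => if j == 0 :> nat then x else if j == 1 :> nat then y else z end.
have neq u : e c u -> u != c by apply: contraTneq => ->; rewrite irrE.
exists f.
- move=> [i|[[|[|[|//]]] hi]] [j|[[|[|[|//]]] hj]] //=; rewrite /f /=;
    rewrite ?ord1 //; try (by move=> E; move: (neq _ cx) (neq _ cy) (neq _ cz) xy xz yz;
      rewrite ?E ?eqxx); by move=> _; congr inr; apply: val_inj.
- move=> [i|[[|[|[|//]]] hi]] [j|[[|[|[|//]]] hj]] //=; rewrite /f /= ?irrE ?cx ?cy ?cz //;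
  first [by apply/negbTE | by rewrite symE ?cx ?cy ?cz //; apply/negbTE].
Qed.

(** * Components of induced subgraphs *)

Section Reach.
Variables (T : finType) (e : rel T).
Hypothesis symE : symmetric e.
Implicit Types (W X Y D : {set T}) (r x y u : T).

Definition reach X r : {set T} := [set y | (r \in X) && connect (induced e X) r y].

Lemma reach_refl X r : r \in X -> r \in reach X r.
Proof. by rewrite inE connect0 => ->. Qed.

(** The induction principle for components; it replaces explicit paths in nearly all later
    arguments. *)
Lemma reach_closed X r (A : {set T}) : (r \in X -> r \in A) ->
  (forall x y, x \in A -> x \in X -> y \in X -> e x y -> y \in A) -> reach X r \subset A.
Proof.
move=> rA clA; apply/subsetP => y; rewrite inE => /andP[rX /connectP[p]].
move: (rA rX) => {rA}; elim: p r rX => [|x p IH] r rX rA /=; first by move=> _ ->.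
case/andP=> /and3P[_ xX rx] px; exact: IH xX (clA _ _ rA rX xX rx) px.
Qed.

Lemma reach_sub X r : reach X r \subset X.
Proof. by apply: reach_closed. Qed.

Lemma reach_in X r y : y \in reach X r -> y \in X.
Proof. exact: (subsetP (reach_sub X r)). Qed.

Lemma reach_step X r x y : x \in reach X r -> y \in X -> e x y -> y \in reach X r.
Proof.
move=> xr yX xy; have xX := reach_in xr; move: xr; rewrite !inE => /andP[-> rx] /=.
by apply: connect_trans rx (connect1 _); rewrite /induced /= xX yX.
Qed.

Lemma reach_mono X Y r : X \subset Y -> reach X r \subset reach Y r.
Proof.
move=> /subsetP XY; apply: reach_closed => [rX|x y xr xX yX]; first exact/reach_refl/XY.
by apply: reach_step => //; apply: XY.
Qed.

Lemma reach_sym X r y : y \in reach X r -> r \in reach X y.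
Proof.
move=> yr; have yX := reach_in yr; move: yr; rewrite !inE yX => /andP[_ ry] /=.
rewrite (@sym_connect_sym _ (induced e X)) // => a b; by rewrite /induced /= symE andbCA.
Qed.

Lemma reach_eq X r y : y \in reach X r -> reach X y = reach X r.
Proof.
have sub a b : a \in reach X b -> reach X a \subset reach X b.
  by move=> ab; apply: reach_closed => // c d cb _; apply: reach_step.
by move=> yr; apply/eqP; rewrite eqEsubset !sub // reach_sym.
Qed.

Lemma reach_idem X r : reach (reach X r) r = reach X r.
Proof.
apply/eqP; rewrite eqEsubset reach_sub /=; apply: reach_closed => [rX|x y xr xX yX xy].
  exact/reach_refl/reach_refl.
by apply: (reach_step xr _ xy); apply: (reach_step (reach_in xr)).
Qed.

Lemma connects_reach W X r : r \in W -> connects e W X = (W \subset reach X r).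
Proof.
move=> rW; apply/idP/subsetP.
  move=> /forall_inP cX x xW; have /forall_inP/(_ _ xW)/and3P[rX _ c] := cX _ rW.
  by rewrite inE rX.
move=> sW; apply/forall_inP => u uW; apply/forall_inP => v vW.
have ru := sW _ uW; have rv := sW _ vW.
rewrite (reach_in ru) (reach_in rv) /=.
by move: rv; rewrite -(reach_eq ru) inE => /andP[].
Qed.

Lemma connects_monotone W X Y : X \subset Y -> connects e W X -> connects e W Y.
Proof.
have [->|[r rW]] := set_0Vmem W.
  by move=> _ _; apply/forall_inP => u; rewrite inE.
by move=> XY; rewrite !(connects_reach _ rW) => /subset_trans; apply; apply: reach_mono.
Qed.


End Reach.

(** * Cuts in a minimal solution *)

Section MinimalSolutions.
Variables (T : finType) (e : rel T) (W : {set T}) (r : T).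
Hypotheses (gE : simple_graph e) (cfE : claw_free e) (rW : r \in W).
Implicit Types (X Y D : {set T}) (x y u v w z : T).

Let symE : symmetric e := gE.1.
Let claw := claw_free_three gE cfE.

Lemma claw_contra c x y z : e c x -> e c y -> e c z ->
  x != y -> x != z -> y != z -> ~~ e x y -> ~~ e x z -> ~~ e y z -> False.
Proof.
move=> cx cy cz xy xz yz nxy nxz nyz; move: (claw cx cy cz xy xz yz).
by rewrite (negbTE nxy) (negbTE nxz) (negbTE nyz).
Qed.

Lemma reach_sepE X x y : y \in X -> y \notin reach e X r -> x \in reach e X r ->
  (x != y) /\ ~~ e x y.
Proof.
move=> yX yr xr; split; first by apply: contraNneq yr => <-.
by apply/negP => xy; move/negP: yr; apply; apply: reach_step xr yX xy.
Qed.

Section OneSolution.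
Variable X : {set T}.
Hypothesis minX : minset (connects e W) X.

Lemma minW x : x \in W -> x \in reach e X r.
Proof.
by move: (minsetp minX); rewrite (connects_reach symE _ rW) => /subsetP; apply.
Qed.

(** The component of [r] already connects the terminals, so minimality leaves nothing outside it. *)
Lemma min_connected : reach e X r = X.
Proof.
apply: (minsetinf minX); last exact: reach_sub.
by rewrite (connects_reach symE _ rW) reach_idem; apply/subsetP => x; apply: minW.
Qed.

Lemma minW_in x : x \in W -> x \in X.
Proof. by move/minW; rewrite min_connected. Qed.

Lemma min_cut u : u \in X -> exists2 s, s \in W & s \notin reach e (X :\ u) r.
Proof.
move=> uX; apply/subsetPn; rewrite -(connects_reach symE _ rW); apply/negP => cX.
by move: uX; rewrite -(minsetinf minX cX (subD1set _ _)) !inE eqxx.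
Qed.

(** A component of [X :\ u] without a neighbour of [u] would be closed in all of [X], which is
    connected and contains [u]. *)
Lemma attach u x : u \in X -> x \in X :\ u ->
  exists2 c, c \in reach e (X :\ u) x & e u c.
Proof.
move=> uX xXu; apply/exists_inP; apply: contraT => /exists_inPn no.
have xX : x \in X by move: xXu; rewrite inE => /andP[].
have /subsetP sub : reach e X x \subset reach e (X :\ u) x.
  apply: reach_closed => [_|a b ar aX bX ab]; first exact: reach_refl.
  have [bu|bu] := eqVneq b u; first by move: (no _ ar); rewrite symE -bu ab.
  by apply: (reach_step ar _ ab); rewrite !inE bu.
have : u \in reach e X x by rewrite (reach_eq symE (_ : x \in reach e X r)) min_connected.
by move/sub/reach_in; rewrite !inE eqxx.
Qed.

Lemma root_in_cut u : u \in X -> u \notin W -> r \in X :\ u.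
Proof.
by move=> uX uW; rewrite !inE (minW_in rW) andbT; apply: contraNneq uW => <-.
Qed.

Lemma min_cut_far u : u \in X -> u \notin W ->
  exists2 s, s \in W & (s \in X :\ u) && (s \notin reach e (X :\ u) r).
Proof.
move=> uX uW; have [s sW sr] := min_cut uX; exists s => //.
by rewrite sr andbT !inE minW_in // andbT; apply: contraNneq uW => <-.
Qed.

(** Since [u] cuts off a terminal, it also has a neighbour away from the component of [r]; this one
    and two nonadjacent near neighbours would form a claw. *)
Lemma near_side_clique u a b : u \in X -> u \notin W -> e u a -> e u b ->
  a \in reach e (X :\ u) r -> b \in reach e (X :\ u) r -> (a == b) || e a b.
Proof.
move=> uX uW ua ub ar br; apply/negPn/negP => /norP[ab nab].
have [s sW /andP[sX sr]] := min_cut_far uX uW.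
have [c cs uc] := attach uX sX.
have cX := reach_in cs.
have cr : c \notin reach e (X :\ u) r.
  apply: contra sr => cr; rewrite -(reach_eq symE cr); exact: reach_sym cs.
have [ac nac] := reach_sepE cX cr ar; have [bc nbc] := reach_sepE cX cr br.
exact: claw_contra ua ub uc ab ac bc nab nac nbc.
Qed.

Lemma far_side_clique u a b : u \in X -> u \notin W -> e u a -> e u b ->
  a \in X :\ u -> b \in X :\ u ->
  a \notin reach e (X :\ u) r -> b \notin reach e (X :\ u) r -> (a == b) || e a b.
Proof.
move=> uX uW ua ub aX bX ar br; apply/negPn/negP => /norP[ab nab].
have [d dr ud] := attach uX (root_in_cut uX uW).
have [da nda] := reach_sepE aX ar dr; have [db ndb] := reach_sepE bX br dr.
exact: claw_contra ud ua ub da db ab nda ndb nab.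
Qed.

(** Neighbours of [u] in different far components would be distinct and nonadjacent, against
    [far_side_clique]. *)
Lemma far_side_connected u x y : u \in X -> u \notin W ->
  x \in X :\ u -> y \in X :\ u ->
  x \notin reach e (X :\ u) r -> y \notin reach e (X :\ u) r ->
  y \in reach e (X :\ u) x.
Proof.
move=> uX uW xX yX xr yr.
have far z c : z \notin reach e (X :\ u) r -> c \in reach e (X :\ u) z ->
    c \notin reach e (X :\ u) r.
  move=> zr cz; apply: contra zr => cr; rewrite -(reach_eq symE cr); exact: reach_sym cz.
have [a ax ua] := attach uX xX; have [b yb ub] := attach uX yX.
have := far_side_clique uX uW ua ub (reach_in ax) (reach_in yb) (far _ _ xr ax) (far _ _ yr yb).
suff bx : (a == b) || e a b -> b \in reach e (X :\ u) x.
  by move/bx => {}bx; rewrite -(reach_eq symE bx); apply: reach_sym.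
case/orP => [/eqP <- //|ab]; exact: reach_step ax (reach_in yb) ab.
Qed.

End OneSolution.

(** * Separation certificates and search prefixes *)

Definition separates D u t := exists a b, [/\ a \in reach e (D :\ u) r,
  b \in reach e (D :\ u) t, e u a, e u b & (a != b) && ~~ e a b].

Lemma separates_mono D D' u t : D \subset D' -> separates D u t -> separates D' u t.
Proof.
move=> DD' [a [b [ar bt ua ub ab]]]; exists a, b; split => //.
  exact: (subsetP (reach_mono _ _ (setSD _ DD'))).
exact: (subsetP (reach_mono _ _ (setSD _ DD'))).
Qed.

(** The certificate is monotone in [D], yet decisive in every minimal [X] around [D]: if [t] were
    still on the side of [r], then [a] and [b] would be nonadjacent neighbours of [u] on its near
    side. *)
Lemma separates_min X D u t : minset (connects e W) X -> D \subset X -> u \in D ->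
  u \notin W -> separates D u t -> t \notin reach e (X :\ u) r.
Proof.
move=> minX DX uD uW /(separates_mono DX)[a [b [ar bt ua ub]]].
have uX := subsetP DX _ uD; rewrite -negb_or; apply: contra => tr.
apply: (near_side_clique minX uX uW ua ub ar).
by rewrite -(reach_eq symE tr).
Qed.

(* The prefixes [D] of a search order of the solution [Y] started at [r];
   [z] is the vertex added last.  A nonterminal [z] is left immediately, away from
   [D :\ z], and terminals next to [D] are taken first.  So, apart from the pendant
   path ending in [z], every nonterminal of [D] already separates two terminals. *)
Definition search_prefix Y D z : Prop :=
  [/\ D \subset Y, z \in D, r \in D & D \subset reach e D r] /\
  [/\ z \notin W -> D :\ z \subset reach e (D :\ z) r,
      z \notin W -> forall t d, t \in W -> d \in D :\ z -> e d t -> t \in D &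
      forall u, u \in D -> u \notin W -> u != z ->
        exists2 t, t \in D & ((t \in W) || (t == z)) /\ separates D u t].

Lemma search_prefix0 Y : r \in Y -> search_prefix Y [set r] r.
Proof.
move=> rY; split; split; rewrite ?sub1set ?inE ?rW //.
  by rewrite eqxx connect0.
by move=> u; rewrite inE => /eqP ->; rewrite rW.
Qed.

(** A nonterminal old tip [z] gets its certificate from [w], which no other vertex of [D] sees. A
    certificate that points to such a [z] is redirected to [w] along the edge between them. *)
Lemma search_prefix_add Y D z w : search_prefix Y D z -> w \in Y -> w \notin D ->
  (exists2 d, d \in D & e d w) ->
  (w \in W \/ forall t d, t \in W -> d \in D -> e d t -> t \in D) ->
  (z \notin W -> e z w /\ forall d, d \in D :\ z -> ~~ e d w) ->
  search_prefix Y (w |: D) w.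
Proof.
move=> [[DY zD rD Dr] [Dzr _ sepD]] wY wD [d dD dw] eager tip.
have DwD : D \subset w |: D by apply: subsetUr.
have E : (w |: D) :\ w = D by rewrite setU1K.
split; split; rewrite ?E //.
- by rewrite subUset sub1set wY.
- by rewrite !inE eqxx.
- by rewrite inE rD orbT.
- apply/subsetP => x; rewrite inE => /orP[|xD]; last first.
    by apply: (subsetP (reach_mono _ _ DwD)); apply: (subsetP Dr).
  rewrite inE => /eqP ->; apply: (reach_step _ _ dw); last by rewrite !inE eqxx.
  by apply: (subsetP (reach_mono _ _ DwD)); apply: (subsetP Dr).
- by case: eager => [-> //|H] _ t c tW cD ct; rewrite inE (H _ _ tW cD ct) orbT.
move=> u; rewrite !inE => /orP[/eqP-> _ /eqP //|uD] uW uw.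
have wDu : w \in (w |: D) :\ u by rewrite !inE eqxx eq_sym uw.
have [uz|uz] := eqVneq u z.
  have zW : z \notin W by rewrite -uz.
  have [zw nzw] := tip zW; subst u.
  have rz : r \in D :\ z by rewrite !inE rD andbT; apply: contraNneq zW => <-.
  have [a aDz za] : exists2 a, a \in D :\ z & e z a.
    apply/exists_inP; apply: contraT => /exists_inPn no.
    have /subsetP sub : reach e D r \subset D :\ z.
      apply: reach_closed => // x y xDz _ yD xy; rewrite !inE yD andbT.
      by apply: contraTneq xy => ->; rewrite symE no.
    by have := sub _ (subsetP Dr _ zD); rewrite !inE eqxx.
  exists w; first by rewrite !inE eqxx.
  rewrite eqxx orbT; split => //; exists a, w; split => //.
  - apply: (subsetP (reach_mono _ _ (setSD _ DwD))); exact: (subsetP (Dzr zW)).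
  - exact: reach_refl.
  - rewrite nzw // andbT; apply: contraNneq wD => <-; by move: aDz; rewrite inE => /andP[].
have [t tD [/orP[tW|/eqP tz] sep]] := sepD u uD uW uz.
  exists t; first by rewrite inE tD orbT.
  by rewrite tW; split => //; apply: separates_mono sep.
have [zW|zW] := boolP (z \in W).
  exists t; first by rewrite inE tD orbT.
  by rewrite tz zW; split => //; rewrite -tz; apply: separates_mono sep.
have [zw nzw] := tip zW; exists w; first by rewrite !inE eqxx.
rewrite eqxx orbT; split => //.
have [a [b [ar bt ua ub ab]]] := separates_mono DwD sep; exists a, b; split => //.
suff tw : t \in reach e ((w |: D) :\ u) w by rewrite -(reach_eq symE tw).
apply: (reach_step (reach_refl _ wDu)); last by rewrite symE tz.
by rewrite !inE tD orbT andbT tz eq_sym.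
Qed.

(** In order of priority, [w] is a terminal next to [D]; any vertex next to [D], if [z] is a
    terminal; a neighbour of [z] beyond the cut that [z] makes in [Y], hence out of sight of
    [D :\ z]. *)
Lemma search_prefix_next Y D z : minset (connects e W) Y -> search_prefix Y D z -> D != Y ->
  exists w, [/\ w \in Y, w \notin D, search_prefix Y (w |: D) w & exists2 d, d \in D & e d w] /\
   (w \in W \/ forall t d, t \in W -> d \in D -> e d t -> t \in D) /\
   (z \notin W -> e z w /\ forall d, d \in D :\ z -> ~~ e d w).
Proof.
move=> minY invD DY; have [[sDY zD rD Dr] [Dzr tz sepD]] := invD.
suff [w [wY wD wadj wW wz]] : exists w, [/\ w \in Y, w \notin D, exists2 d, d \in D & e d w,
   (w \in W \/ forall t d, t \in W -> d \in D -> e d t -> t \in D) &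
   (z \notin W -> e z w /\ forall d, d \in D :\ z -> ~~ e d w)].
  by exists w; split; split => //; apply: search_prefix_add wz.
have [/exists_inP[t tW /andP[tD /exists_inP[d dD dt]]]|] :=
    boolP [exists t in W, (t \notin D) && [exists d in D, e d t]].
  exists t; split => //; [exact: minW_in tW|by exists d|by left|].
  move=> zW.
  (* Terminals next to [D :\ z] were taken earlier, so [t] can hang only on [z]. *)
  have no c : c \in D :\ z -> ~~ e c t by move=> cD; apply: contra tD; apply: tz.
  split => //; have [<- //|dz] := eqVneq d z.
  by move: (no d); rewrite !inE dz dD dt => /(_ isT).
move=> /exists_inPn none.
have noW t d : t \in W -> d \in D -> e d t -> t \in D.
  move=> tW dD dt; apply: contraNT (none t tW) => ->; by apply/exists_inP; exists d.
have [zW|zW] := boolP (z \in W).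
  have [w wY [wD wadj]] : exists2 w, w \in Y & (w \notin D /\ exists2 d, d \in D & e d w).
    case: (pickP [pred w in Y | (w \notin D) && [exists d in D, e d w]]).
      by move=> w /and3P[wY wD /exists_inP wadj]; exists w.
    move=> no; case/negP: DY; rewrite eqEsubset sDY -(min_connected minY).
    apply: reach_closed => // x y xD _ yY xy; move: (no y); rewrite inE /= yY.
    by case: (y \in D) => //= /negbT/exists_inPn/(_ _ xD); rewrite xy.
  by exists w; split => //; right.
have zY := subsetP sDY _ zD.
have [s sW /andP[sY sr]] := min_cut_far minY zY zW.
have [w ws zw] := attach minY zY sY.
have wr : w \notin reach e (Y :\ z) r.
  apply: contra sr => wr; rewrite -(reach_eq symE wr); exact: reach_sym ws.
have sub : D :\ z \subset reach e (Y :\ z) r.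
  by apply: subset_trans (Dzr zW) _; apply: reach_mono; apply: setSD.
have := reach_in ws; rewrite !inE => /andP[wz wY].
exists w; split => //.
- by apply: contra wr => wD; apply: (subsetP sub); rewrite !inE wz.
- by exists z.
- by right.
move=> _; split => // d dD; have [] // := reach_sepE (reach_in ws) wr (subsetP sub _ dD).
Qed.

(** * Rerouting one solution towards another *)

Definition reroute X v w : {set T} := let C := reach e (X :\ v) r in
  [set y | [|| y == w, y \in C | [forall x in C, ~~ e x y]]].

Section Progress.
Variables (X Y D : {set T}) (z w : T).
Hypotheses (minX : minset (connects e W) X) (minY : minset (connects e W) Y).
Hypotheses (prefD : search_prefix Y D z) (DX : D \subset X).
Hypotheses (wX : w \notin X) (wY : w \in Y).
Hypotheses (wadj : exists2 d, d \in D & e d w).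
Hypothesis noW : forall t d, t \in W -> d \in D -> e d t -> t \in D.
Hypothesis tip : z \notin W -> e z w /\ forall d, d \in D :\ z -> ~~ e d w.

Let near v := reach e (X :\ v) r.
Let far v := (X :\ v) :\: near v.
Let Z v := reroute X v w.
Let F := [set v in X :\: D | [exists d in D, e d v]].

Lemma FP v : v \in F -> [/\ v \in X, v \notin D, v \notin W & exists2 d, d \in D & e d v].
Proof.
rewrite !inE -andbA => /and3P[vD vX /exists_inP[d dD dv]]; split => //; last by exists d.
by apply: contra vD => vW; apply: noW vW dD dv.
Qed.

Lemma near_prefix v : v \notin D -> D \subset near v.
Proof.
move=> vD; case: prefD => [[_ _ _ Dr] _]; apply: subset_trans Dr _; apply: reach_mono.
by apply/subsetP => x xD; rewrite !inE (subsetP DX) // andbT; apply: contraNneq vD => <-.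
Qed.

Lemma in_near v x : x \in near v -> x \in X.
Proof. by move/reach_in; rewrite !inE => /andP[]. Qed.

Lemma near_far v x y : x \in near v -> y \in far v -> x != y /\ ~~ e x y.
Proof. by move=> xn; rewrite inE => /andP[yn yX]; apply: reach_sepE xn. Qed.

(** The far component of [u] hangs on [u] and avoids [v], so after deleting [v] it is still attached
    to [u], which is near. *)
Lemma swap_cut u v s : u \in X -> v \in X -> u \in near v -> v \in near u ->
  s \in far u -> s \in near v.
Proof.
move=> uX vX uv vu; rewrite inE => /andP[su sX].
have [c cs uc] := attach minX uX sX.
have vc : v \notin reach e (X :\ u) c.
  apply: contra su; rewrite (reach_eq symE cs) => vs.
  by rewrite /near -(reach_eq symE vu); apply: reach_sym.
have : s \in reach e (X :\ u) c by apply: reach_sym.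
have cX : c \in X :\ u := reach_in cs.
have inXv y : y \in reach e (X :\ u) c -> y \in X :\ v.
  move=> yc; move: (reach_in yc); rewrite !inE => /andP[_ ->]; rewrite andbT.
  by apply: contraNneq vc => <-.
have cv : c \in near v by apply: (reach_step uv _ uc); apply/inXv/reach_refl.
suff /subsetP sub : reach e (X :\ u) c \subset near v :&: reach e (X :\ u) c.
  by move/sub; rewrite inE => /andP[].
apply: reach_closed => [_|x y]; first by rewrite inE cv reach_refl.
rewrite inE => /andP[xv xc] xX yX xy; have yc := reach_step xc yX xy.
by rewrite inE yc andbT; apply: (reach_step xv _ xy); apply: inXv.
Qed.

Lemma F_near v v' : v \in F -> v' \in F -> v != v' -> v' \in near v.
Proof.
move=> /FP[vX vD _ _] /FP[vX' _ _ [d dD dv']] vv'.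
apply: (reach_step (subsetP (near_prefix vD) _ dD) _ dv').
by rewrite !inE eq_sym vv' vX'.
Qed.

(** By [swap_cut], what one frontier vertex cuts off lies on the near side of every other. *)
Lemma far_apart v v' c c' : v \in F -> v' \in F -> v != v' ->
  c \in far v -> c' \in far v' -> c' != c /\ ~~ e c' c.
Proof.
move=> vF vF' vv' cv cv'; apply: near_far cv.
have [vX _ _ _] := FP vF; have [vX' _ _ _] := FP vF'.
by apply: (swap_cut vX' vX _ _ cv'); rewrite F_near // eq_sym.
Qed.

(** Nothing lies beyond the frontier except far sides: a near neighbour of [a] in [F] equals or is
    adjacent to the neighbour of [a] in [D], because both belong to the near clique of [a]. *)
Lemma solution_cover x : x \in X -> [\/ x \in D, x \in F | exists2 v, v \in F & x \in far v].
Proof.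
pose G := D :|: F :|: \bigcup_(v in F) far v.
suff /subsetP sub : X \subset G.
  move/sub; rewrite !(in_setU) -orbA => /or3P[?|?|/bigcupP[v vF xv]].
  - by constructor 1.
  - by constructor 2.
  - by constructor 3; exists v.
have rD : r \in D by case: prefD => [[]].
have DG y : y \in D -> y \in G by move=> yD; rewrite !in_setU yD.
have FG y : y \in F -> y \in G by move=> yF; rewrite !in_setU yF orbT.
have fG v y : v \in F -> y \in far v -> y \in G.
  by move=> vF yv; rewrite !in_setU; apply/orP; right; apply/bigcupP; exists v.
have DFG d y : d \in D -> y \in X -> e d y -> y \in G.
  move=> dD yX dy; have [/DG //|yD] := boolP (y \in D).
  by apply: FG; rewrite !inE yD yX /=; apply/exists_inP; exists d.
rewrite -(min_connected minX); apply: reach_closed => [_|a y aG _ yX ay]; first exact: DG.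
have [ya|ya] := eqVneq y a; first by rewrite ya.
case/setUP: aG => [/setUP[aD|aF]|/bigcupP[v vF av]].
- exact: DFG ay.
- have [aX aD aW [d dD da]] := FP aF.
  have [yn|yn] := boolP (y \in near a).
    have dn : d \in near a := subsetP (near_prefix aD) _ dD.
    have ad : e a d by rewrite symE.
    have /orP[/eqP <-|] := near_side_clique minX aX aW ad ay dn yn; first exact: DG.
    exact: DFG.
  by apply: (fG a) => //; rewrite in_setD yn in_setD1 ya yX.
- have [->|yv] := eqVneq y v; first exact: FG.
  apply: (fG v) => //; rewrite in_setD in_setD1 yv yX !andbT; apply/negP => yn.
  by have [_] := near_far yn av; rewrite symE ay.
Qed.

Lemma far_nonempty v : v \in F -> exists2 c, c \in far v & e v c.
Proof.
move=> /FP[vX _ vW _]; have [s sW /andP[sX sr]] := min_cut_far minX vX vW.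
have [c cs vc] := attach minX vX sX; exists c => //; rewrite inE (reach_in cs) andbT.
apply: contra sr => cr; rewrite -(reach_eq symE cr); exact: reach_sym cs.
Qed.

(** Among [q], [d] and a far neighbour of [v], claw-freeness at [v] leaves only the edge from [q] to
    the far neighbour. *)
Lemma hook v q d : v \in F -> q \notin X -> e v q -> d \in D -> e v d -> ~~ e q d ->
  exists2 c, c \in far v & e q c.
Proof.
move=> vF qX vq dD vd nqd; have [c cv vc] := far_nonempty vF; exists c => //.
have [vX vD _ _] := FP vF.
have dn := subsetP (near_prefix vD) _ dD; have [dc ndc] := near_far dn cv.
apply: contraT => nqc; exfalso; apply: (claw_contra vq vd vc) => //.
- by apply: contraNneq qX => ->; apply: in_near dn.
- by apply: contraNneq qX => ->; move: cv; rewrite !inE => /and3P[].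
Qed.

Lemma far_in_reroute v c : c \in far v -> c \in Z v.
Proof.
move=> cv; rewrite inE; apply/or3P; constructor 3; apply/forall_inP => x xn.
by have [] := near_far xn cv.
Qed.

(** [P] is the detour. It starts at [w], next to [D]; its other vertices see nothing of [near v], so
    it lies in [Z v]; from [q] it enters [far v], which is connected. As [v] is a nonterminal, the
    two sides hold all terminals. *)
Lemma reroute_connects v (P : {set T}) q c : v \in F -> c \in far v -> e q c ->
  w \in P -> P \subset reach e P w -> q \in P ->
  (forall y a, y \in P -> y != w -> a \in near v -> ~~ e a y) -> W \subset reach e (Z v) r.
Proof.
move=> vF cv qc wP Pw qP PC; have [vX vD vW _] := FP vF.
have PZ : P \subset Z v.
  apply/subsetP => y yP; rewrite inE; have [//|yw] := eqVneq y w.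
  by apply/or3P; constructor 3; apply/forall_inP => a an; apply: PC.
have nZ : near v \subset reach e (Z v) r.
  rewrite -{1}[near v]reach_idem; apply: reach_mono; apply/subsetP => y yn.
  by rewrite inE yn orbT.
have [d dD dw] := wadj.
have wZ : w \in reach e (Z v) r.
  apply: (reach_step (subsetP nZ _ (subsetP (near_prefix vD) _ dD)) _ dw).
  exact: (subsetP PZ).
have qZ : q \in reach e (Z v) r.
  by rewrite -(reach_eq symE wZ); apply: (subsetP (reach_mono _ _ PZ)); apply: (subsetP Pw).
have cZ : c \in reach e (Z v) r := reach_step qZ (far_in_reroute cv) qc.
apply/subsetP => x xW; have [/(subsetP nZ) //|xn] := boolP (x \in near v).
have xX : x \in X :\ v.
  by rewrite !inE (minW_in minX) // andbT; apply: contraNneq vW => <-.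
have xc : x \in reach e (X :\ v) c.
  by move: cv; rewrite inE => /andP[cn cX]; apply: far_side_connected.
apply: subsetP xc; apply: subset_trans (_ : reach e (Z v) r :&: far v \subset _);
  last exact: subsetIl.
apply: reach_closed => [_|a b]; first by rewrite inE cZ.
rewrite inE => /andP[aZ av] aX bX ab.
have bv : b \in far v.
  by rewrite inE bX andbT; apply/negP => bn; have [_] := near_far bn av; rewrite symE ab.
by rewrite inE bv andbT; apply: reach_step aZ (far_in_reroute bv) ab.
Qed.

(** Keeps [w] from serving as a bypass around a deleted vertex of [near v]. *)
Definition attaches_by_clique v := forall a b, a \in near v -> b \in near v ->
  e w a -> e w b -> (a == b) || e a b.

Lemma clique_of_outside v h : h \notin near v -> e w h -> (forall a, a \in near v -> ~~ e a h) ->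
  attaches_by_clique v.
Proof.
move=> hn wh nh a b an bn wa wb; apply/negPn/negP => /norP[ab nab].
apply: (claw_contra wa wb wh ab _ _ nab); rewrite ?nh //; by apply: contraNneq hn => <-.
Qed.

Lemma good_vertex_adjacent v c : v \in F -> c \in far v -> e w c ->
  W \subset reach e (Z v) r /\ attaches_by_clique v.
Proof.
move=> vF cv wc; split.
  apply: (@reroute_connects v [set w] w c) => //; rewrite ?inE //.
    by rewrite sub1set reach_refl ?inE.
  by move=> y a; rewrite inE => ->.
apply: (@clique_of_outside v c) => //; last by move=> a an; have [] := near_far an cv.
by move: cv; rewrite inE => /andP[].
Qed.

Lemma wW : w \notin W.
Proof. by apply: contra wX; apply: minW_in. Qed.

(* Walk in [Y] from [w] away from [D] until some [far v] is touched. *)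
Lemma good_vertex : exists2 v, v \in F & W \subset reach e (Z v) r /\ attaches_by_clique v.
Proof.
pose touch q := [exists v in F, (q \in far v) || [exists c in far v, e q c]].
have touchP q v c : v \in F -> c \in far v -> e q c -> touch q.
  move=> vF cv qc; apply/exists_inP; exists v => //; apply/orP; right.
  by apply/exists_inP; exists c.
have [/exists_inP[v vF /orP[wv|/exists_inP[c cv wc]]]|ntw] := boolP (touch w).
- by case/negP: wX; move: wv; rewrite !inE => /and3P[].
- by exists v => //; apply: good_vertex_adjacent wc.
have [s sW /andP[sY sr]] := min_cut_far minY wY wW.
(* [B] and [D] lie in different components of [Y :\ w], so [B] neither meets nor sees [D]. *)
set B := reach e (Y :\ w) s.
have wB : w \notin B by apply/negP => /reach_in; rewrite !inE eqxx.
have [DY _ _ Dr] := prefD.1.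
have wD : w \notin D by apply: contra wX; apply: (subsetP DX).
have Dn : D \subset reach e (Y :\ w) r.
  apply: subset_trans Dr (reach_mono _ _ _); apply/subsetP => x xD.
  by rewrite !inE (subsetP DY) // andbT; apply: contraNneq wD => <-.
have BD y d : y \in B -> d \in D -> d != y /\ ~~ e d y.
  move=> yB dD; apply: (reach_sepE (reach_in yB)); last exact: (subsetP Dn).
  by apply: contra sr => yr; rewrite -(reach_eq symE yr); apply: reach_sym.
(* By [solution_cover], a vertex of [B] that touches no far side is invisible to [X]: an edge to a
   frontier vertex would create a touch by [hook]. *)
have BX y : y \in B -> ~~ touch y -> y \notin X /\ forall a, a \in X -> ~~ e a y.
  move=> yB nty; have yX : y \notin X.
    apply/negP => /solution_cover[yD|yF|[v vF yv]].
    - by have [/eqP] := BD _ _ yB yD.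
    - by have [_ _ _ [d dD dy]] := FP yF; have [_] := BD _ _ yB dD; rewrite dy.
    - by case/negP: nty; apply/exists_inP; exists v => //; rewrite yv.
  split => // a /solution_cover[aD|aF|[v vF av]].
  - by have [] := BD _ _ yB aD.
  - apply/negP => ay; have [_ _ _ [d dD da]] := FP aF; have [_ ndy] := BD _ _ yB dD.
    rewrite symE in da; rewrite symE in ndy.
    by have [c cv yc] := hook aF yX ay dD da ndy; case/negP: nty; exact: (touchP _ _ _ aF cv yc).
  - by apply: contra nty => ay; apply: (touchP _ v a) => //; rewrite symE.
pose H := [set y in w |: B | ~~ touch y].
have wH : w \in H by rewrite !inE eqxx.
(* The terminal [s] lies in [X] and therefore touches, so a walk from [w] to [s] has a first
   touching vertex [q], entered from [x]. *)
have [x [q [xH qB xq tq]]] : exists x q, [/\ x \in reach e H w, q \in B, e x q & touch q].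
  have [b bs wb] := attach minY wY sY.
  have wBs : s \in reach e (w |: B) w.
    apply: (subsetP (_ : reach e B b \subset _)); last first.
      rewrite /B [reach e (Y :\ w) s](_ : _ = reach e (Y :\ w) b) ?reach_idem.
        exact: reach_sym.
      by rewrite (reach_eq symE bs).
    have bw : b \in reach e (w |: B) w.
      exact: (reach_step (reach_refl _ (setU11 _ _)) (setU1r _ bs) wb).
    rewrite -(reach_eq symE bw); apply: reach_mono; exact: subsetUr.
  have ts : touch s.
    have sX : s \in X := minW_in minX sW.
    have sB : s \in B by apply: reach_refl.
    by apply: contraT => nts; have [] := BX _ sB nts; rewrite sX.
  case: (pickP [pred q in B | touch q && [exists x in reach e H w, e x q]]).
    by move=> q /and3P[qB tq /exists_inP[x xH xq]]; exists x, q.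
  move=> no; suff /subsetP/(_ _ wBs)/reach_in : reach e (w |: B) w \subset reach e H w.
    by rewrite inE ts andbF.
  apply: reach_closed => [_|x y xH _ yB xy]; first exact: reach_refl.
  apply: (reach_step xH _ xy); rewrite inE yB /=; apply/negP => ty.
  move: yB; rewrite inE => /orP[/set1P yw|yB]; first by rewrite yw (negbTE ntw) in ty.
  by move/negP: (no y); apply; rewrite inE /= yB ty /=; apply/exists_inP; exists x.
have ntx : ~~ touch x by move: (reach_in xH); rewrite inE => /andP[].
have [v vF /orP[qv|/exists_inP[c cv qc]]] := exists_inP tq.
  by case/negP: ntx; apply: (touchP _ v q).
exists v => //; have [vX vD vW _] := FP vF.
have qX : q \notin X.
  apply/negP => /solution_cover[qD|qF|[v' vF' qv']].
  - by have [/eqP] := BD _ _ qB qD.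
  - by have [_ _ _ [d dD dq]] := FP qF; have [_] := BD _ _ qB dD; rewrite dq.
  - by case/negP: ntx; apply: (touchP _ v' q).
(* Otherwise [q] would have neighbours in two far sides; with [x], which touches none, they form a
   claw at [q]. *)
have qn a : a \in near v -> ~~ e a q.
  move=> an; apply/negP => aq.
  have [v' [c' [vF' vv' cv' qc']]] : exists v' c', [/\ v' \in F, v != v', c' \in far v' & e q c'].
    case: (solution_cover (in_near an)) => [aD|aF|[v' vF' av']].
    - by have [_] := BD _ _ qB aD; rewrite aq.
    - have [_ _ _ [d dD da]] := FP aF; have [_ ndq] := BD _ _ qB dD.
      rewrite symE in da; rewrite symE in ndq.
      have [c' cv' qc'] := hook aF qX aq dD da ndq; exists a, c'; split => //.
      by apply/eqP => va; move/reach_in: an; rewrite va !inE eqxx.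
    - exists v', a; split => //; last by rewrite symE.
      apply/eqP => vv'; move: av'; rewrite -vv' => av.
      by have [/eqP] := near_far an av.
  have [cc' ncc'] := far_apart vF vF' vv' cv cv'.
  have qx : e q x by rewrite symE.
  have nx v1 c1 : v1 \in F -> c1 \in far v1 -> x != c1 /\ ~~ e x c1.
    move=> vF1 cv1; split; last by apply: contra ntx; exact: (touchP _ _ _ vF1 cv1).
    by apply: contraNneq ntx => xc; apply/exists_inP; exists v1 => //; rewrite xc cv1.
  have [xc nxc] := nx _ _ vF cv; have [xc' nxc'] := nx _ _ vF' cv'.
  exact: (claw_contra qx qc' qc xc' xc cc' nxc' nxc ncc').
have Hn y a : y \in H -> y != w -> a \in near v -> ~~ e a y.
  move=> /setIdP[/setU1P[->|yB] nty]; first by rewrite eqxx.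
  by move=> yw an; have [_] := BX y yB nty; apply; apply: in_near an.
split.
  pose P := q |: reach e H w.
  have sP : reach e H w \subset P by apply: subsetUr.
  apply: (@reroute_connects v P q c) => //.
  - by rewrite inE reach_refl ?orbT.
  - apply/subsetP => y; rewrite inE => /orP[/set1P->|yH].
      apply: (reach_step _ _ xq); last by rewrite !inE eqxx.
      by apply: (subsetP (reach_mono _ _ sP)); rewrite reach_idem.
    by apply: (subsetP (reach_mono _ _ sP)); rewrite reach_idem.
  - by rewrite !inE eqxx.
  - by move=> y a /setU1P[-> _|/reach_in]; [apply: qn|apply: Hn].
(* The vertex after [w] on the walk is the outside neighbour that [clique_of_outside] asks for. *)
have [h [hX wh hn]] : exists h, [/\ h \notin X, e w h & forall a, a \in near v -> ~~ e a h].
  have [xw|xw] := eqVneq x w; first by exists q; rewrite -xw.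
  have [/exists_inP[h hH wh]|/exists_inPn none] := boolP [exists h in H, e w h].
    have hw : h != w by apply: contraTneq wh => ->; rewrite gE.2.
    exists h; split => //; last by move=> a; apply: Hn.
    move: hH; rewrite inE => /andP[]; rewrite inE => /orP[/set1P/eqP|]; first by rewrite (negbTE hw).
    by move=> hB nth; have [] := BX _ hB nth.
  have /subsetP/(_ _ xH) : reach e H w \subset [set w].
    apply: reach_closed => [_|a b]; first by rewrite inE.
    by move=> /set1P-> _ bH wb; move: (none _ bH); rewrite wb.
  by rewrite inE (negbTE xw).
by apply: (@clique_of_outside v h) => //; apply: contra hX; apply: in_near.
Qed.

(** The only exit from [near v] within [Z v] leads through [w]. *)
Lemma isolated v u : r \in near v -> (forall k, k \in reach e (near v :\ u) r -> ~~ e w k) ->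
  reach e (Z v :\ u) r \subset reach e (near v :\ u) r.
Proof.
move=> rn nw; apply: reach_closed => [|x y xS xZ].
  by rewrite in_setD1 => /andP[ru _]; apply: reach_refl; rewrite in_setD1 ru.
have xn : x \in near v by move: (reach_in xS); rewrite in_setD1 => /andP[].
rewrite in_setD1 => /andP[yu]; rewrite inE => /or3P[/eqP yw|yn|/forall_inP/(_ _ xn)/negbTE-> //] xy.
- by move: (nw _ xS); rewrite symE -yw xy.
- by apply: (reach_step xS _ xy); rewrite in_setD1 yu.
Qed.

(** A walk may leave [near v] through [w] and return, but it returns to a neighbour of [w], and that
    one equals or is adjacent to the neighbour [k] reached before. *)
Lemma isolated_clique v u : r \in near v -> attaches_by_clique v ->
  reach e (Z v :\ u) r \subset reach e (near v :\ u) r :|: ~: near v.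
Proof.
move=> rn cl; case: (pickP [pred k in reach e (near v :\ u) r | e w k]); last first.
  move=> no; apply: subset_trans (isolated rn _) (subsetUl _ _) => k kS.
  by move: (no k); rewrite inE /= kS => /negbT.
move=> k /andP[kS wk].
have Sn x : x \in reach e (near v :\ u) r -> x \in near v.
  by move/reach_in; rewrite in_setD1 => /andP[].
apply: reach_closed => [|x y xA xZ].
  by rewrite in_setD1 => /andP[ru _]; rewrite in_setU reach_refl // in_setD1 ru.
rewrite in_setD1 in_setU in_setC => /andP[yu yZ] xy.
have [yn|//] := boolP (y \in near v); last by rewrite orbT.
rewrite orbF; have yn' : y \in near v :\ u by rewrite in_setD1 yu.
move: xA; rewrite in_setU in_setC => /orP[xS|xn]; first exact: reach_step xS yn' xy.
move: xZ; rewrite in_setD1 => /andP[_]; rewrite inE (negbTE xn) /=.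
case/orP=> [/eqP xw|/forall_inP/(_ _ yn)]; last by rewrite symE xy.
rewrite xw in xy; have /orP[/eqP <- //|ky] := cl _ _ (Sn _ kS) yn wk xy.
exact: reach_step kS yn' ky.
Qed.

(** In [X], deleting [u] cuts off a terminal [s]. If [s] is near [v], [isolated_clique] carries the
    cut over to [Z v]. If not, the certificate of [u] supplies a near terminal instead, or shows
    that [w] is out of reach. The tip [z] has no certificate; its case is settled by the hypothesis
    on [z]. *)
Lemma reroute_keeps v : v \in F -> attaches_by_clique v ->
  (z \notin W -> (v \in near z) \/ forall k, k \in near v -> k \in near z -> ~~ e w k) ->
  forall u, u \in w |: D -> u \notin W -> exists2 s, s \in W & s \notin reach e (Z v :\ u) r.
Proof.
move=> vF cl tipv u; have [vX vD vW _] := FP vF.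
have [[_ zD rD _] [_ _ sepD]] := prefD; have Dn := near_prefix vD.
have rn : r \in near v by apply: (subsetP Dn).
have nX : near v \subset X by apply/subsetP => x; apply: in_near.
have nearS x : x \in reach e (near v :\ u) r -> x \in near v /\ x \in near u.
  move=> xS; split; first by move/reach_in: xS; rewrite in_setD1 => /andP[].
  by apply: (subsetP (reach_mono _ _ (setSD _ nX))).
case/setU1P => [uw _|uD uW].
  have [s sW /andP[_ sn]] := min_cut_far minX vX vW; exists s => //.
  apply: contra sn; apply: subsetP; rewrite uw; apply: reach_closed => // x y xn _.
  rewrite in_setD1 inE => /andP[/negbTE-> /= /orP[//|/forall_inP/(_ _ xn)/negbTE-> //]].
have uX : u \in X by apply: (subsetP DX).
have keep s : s \in W -> s \in near v -> s \notin near u ->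
    exists2 s, s \in W & s \notin reach e (Z v :\ u) r.
  move=> sW sn su; exists s => //; apply: contra su => /(subsetP (isolated_clique u rn cl)).
  by rewrite in_setU in_setC sn orbF => /nearS[].
have far_keep s : s \in W -> s \notin near u ->
    (forall k, k \in reach e (near v :\ u) r -> ~~ e w k) ->
    exists2 s, s \in W & s \notin reach e (Z v :\ u) r.
  move=> sW su no; exists s => //; apply: contra su => /(subsetP (isolated rn no)).
  by case/nearS.
have [s sW /andP[sX su]] := min_cut_far minX uX uW.
have [sn|sn] := boolP (s \in near v); first exact: (keep s).
have [uz|uz] := eqVneq u z.
  rewrite -uz in tipv; case: (tipv uW) => [vz|no].
    case/negP: sn; apply: (swap_cut uX vX _ vz); first exact: (subsetP Dn).
    by rewrite inE su.
  by apply: (far_keep s) => // k /nearS[kn ku]; apply: no.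
have [t tD [tWz sep]] := sepD u uD uW uz.
have tu := separates_min minX DX uD uW sep; have tn := subsetP Dn _ tD.
have [/keep/(_ tn tu) //|tW] := boolP (t \in W).
move: tWz; rewrite (negbTE tW) => /eqP tz; rewrite tz in tW tu tn.
apply: (far_keep s) => // k kS; apply/negP => wk.
have [kn ku] := nearS _ kS; have [zw _] := tip tW; rewrite symE in zw.
case/negP: tu; have /orP[/eqP <- //|kz] := cl _ _ kn tn wk zw.
by apply: (reach_step ku _ kz); rewrite in_setD1 eq_sym uz (subsetP DX).
Qed.

Lemma progress : exists v, W \subset reach e (Z v) r /\
  forall X', minset (connects e W) X' -> X' \subset Z v -> w |: D \subset X'.
Proof.
suff [v vF [cW [cl tipv]]] : exists2 v, v \in F & W \subset reach e (Z v) r /\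
   (attaches_by_clique v /\
   (z \notin W -> (v \in near z) \/ forall k, k \in near v -> k \in near z -> ~~ e w k)).
  exists v; split => // X' minX' X'Z; apply/subsetP => u uwD; apply: contraT => uX'.
  have [/(minW_in minX')|uW] := boolP (u \in W); first by rewrite (negbTE uX').
  have [s sW /negP[]] := reroute_keeps vF cl tipv uwD uW.
  apply: subsetP (minW minX' sW); apply: reach_mono.
  by apply/subsetP => x xX'; rewrite in_setD1 (subsetP X'Z) // andbT; apply: contraNneq uX' => <-.
have [v vF [cW cl]] := good_vertex.
(* The hypothesis on the tip fails only through some [k] near both [v] and [z] that sees [w].
   Cliques at [w] and at [z] then put [k] into [F], [hook] joins [w] to [far k], and [k] can replace
   [v]. *)
case: (pickP [pred k | [&& z \notin W, k \in near v, k \in near z & e w k]]); last first.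
  move=> no; exists v => //; split => //; split => // zW; right => k kn kz.
  by move: (no k); rewrite inE zW kn kz /= => /negbT.
move=> k /and4P[zW kn kz wk]; have [[_ zD rD Dr] [Dzr _ _]] := prefD.
have zX := subsetP DX _ zD; have [_ vD _ _] := FP vF.
have [zw nDw] := tip zW.
have zk : e z k.
  have wz : e w z by rewrite symE.
  have /orP[/eqP E|//] := cl _ _ (subsetP (near_prefix vD) _ zD) kn wz wk.
  by move/reach_in: kz; rewrite -E !inE eqxx.
have [d dDz zd] : exists2 d, d \in D :\ z & e z d.
  apply/exists_inP; apply: contraT => /exists_inPn none.
  have /subsetP sub : reach e D r \subset D :\ z.
    apply: reach_closed => [_|x y xDz _ yD xy].
      by rewrite !inE rD andbT; apply: contraNneq zW => <-.
    by rewrite !inE yD andbT; apply: contraTneq xy => ->; rewrite symE none.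
  by have := sub _ (subsetP Dr _ zD); rewrite !inE eqxx.
have dD : d \in D by move: dDz; rewrite inE => /andP[].
have kD : k \notin D.
  apply: contraL wk => kD; rewrite symE nDw // in_setD1 kD andbT.
  by apply: contraTneq kz => ->; apply/negP => /reach_in; rewrite !inE eqxx.
have dz : d \in near z.
  apply: (subsetP (reach_mono _ _ (setSD _ DX))); exact: (subsetP (Dzr zW)).
have dk : e d k.
  have /orP[/eqP E|//] := near_side_clique minX zX zW zd zk dz kz.
  by rewrite -E dD in kD.
have kF : k \in F.
  by rewrite !inE kD (in_near kn) /=; apply/exists_inP; exists d.
have kw : e k w by rewrite symE.
have kd : e k d by rewrite symE.
have nwd : ~~ e w d by rewrite symE nDw.
have [c cf wc] := hook kF wX kw dD kd nwd.
have [cW' cl'] := good_vertex_adjacent kF cf wc.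
by exists k => //; split => //; split => // _; left.
Qed.

End Progress.

(** Induction on the number of vertices of [Y] missing from [D]. If [X] contains the next vertex,
    only [D] grows; otherwise [progress] also supplies a new [X]. At [D = Y], minimality of [X]
    gives [X = Y]. *)
Lemma reroute_closed_complete (V : {set {set T}}) :
  (forall X, X \in V -> minset (connects e W) X) ->
  (forall X v w, X \in V -> connects e W (reroute X v w) ->
     exists2 X', X' \in V & X' \subset reroute X v w) ->
  V != set0 -> forall Y, minset (connects e W) Y -> Y \in V.
Proof.
move=> minV clV /set0Pn[X0 X0V] Y minY.
suff loop n D z X : #|Y| <= n + #|D| -> search_prefix Y D z -> X \in V -> D \subset X -> Y \in V.
  have prefY : search_prefix Y [set r] r by apply: search_prefix0; apply: minW_in.
  apply: (loop #|Y| _ _ X0 _ prefY X0V); first exact: leq_addr.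
  by rewrite sub1set (minW_in (minV _ X0V)).
have stop D1 X1 : D1 \subset X1 -> X1 \in V -> D1 = Y -> Y \in V.
  by move=> DX XV E; rewrite -E (minsetinf (minV _ XV) _ DX) // E; apply: minsetp minY.
elim: n D z X => [|n IH] D z X cD pref XV DX.
  apply: (stop D X) => //; apply/eqP; rewrite eqEcard cD andbT; by case: pref => [[]].
have [E|DY] := eqVneq D Y; first exact: (stop D X).
have [w [[wY wD pref' wadj] [eager tip]]] := search_prefix_next minY pref DY.
have cD' : #|Y| <= n + #|w |: D| by rewrite cardsU1 wD addnCA addnA.
have [wX|wX] := boolP (w \in X).
  by apply: (IH _ w X cD' pref') => //; rewrite subUset sub1set wX.
have noW t d : t \in W -> d \in D -> e d t -> t \in D.
  case: eager => [wW'|//]; last by move=> h; apply: h.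
  by rewrite (minW_in (minV _ XV)) in wX.
have [v [cW keep]] := progress (minV _ XV) minY pref DX wX wY wadj noW tip.
have [|X' X'V X'Z] := clV X v w XV; first by rewrite (connects_reach symE _ rW).
by apply: (IH _ w X' cD' pref' X'V); apply: keep => //; apply: minV.
Qed.

End MinimalSolutions.

(** * A language with bounded loops *)

(** Conditions have no syntax of their own: a test asks for a positive value, and truncated
    subtraction expresses comparison. *)
Inductive expr : Type :=
  | Cst of nat
  | Var of nat
  | Arr of nat & expr
  | Plus of expr & expr
  | Minus of expr & expr.

(* [For i c] runs [c] for [i = 0, ..., n - 1], where [n] is variable 0. *)
Inductive cmd : Type :=
  | Asg of nat & expr
  | Sto of nat & expr & expr
  | Seq of cmd & cmd
  | If of expr & cmd & cmd
  | For of nat & cmd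
  | Rd of nat
  | Pr of expr.

Record store : Type := Store {
  var : nat -> nat;
  arr : nat -> nat -> nat;
  rest : seq nat;
  printed : seq nat
}.

Definition setv (s : store) x v := Store (upd (var s) x v) (arr s) (rest s) (printed s).

Definition seta (s : store) a i v :=
  Store (var s) (fun b => if b == a then upd (arr s a) i v else arr s b) (rest s) (printed s).

Fixpoint ev (x : expr) (s : store) : nat :=
  match x with
  | Cst c => c
  | Var y => var s y
  | Arr a y => arr s a (ev y s)
  | Plus y z => ev y s + ev z s
  | Minus y z => ev y s - ev z s
  end.

Fixpoint run (c : cmd) (s : store) : store :=
  match c with
  | Asg x y => setv s x (ev y s)
  | Sto a y z => seta s a (ev y s) (ev z s)
  | Seq c1 c2 => run c2 (run c1 s)
  | If y c1 c2 => if 0 < ev y s then run c1 s else run c2 s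
  | For i c1 => iter (var s 0) (fun s' => let s1 := run c1 s' in setv s1 i (var s1 i).+1) (setv s i 0)
  | Rd x => Store (upd (var s) x (head 0 (rest s))) (arr s) (behead (rest s)) (printed s)
  | Pr y => Store (var s) (arr s) (rest s) (rcons (printed s) (ev y s))
  end.

Fixpoint wvars (c : cmd) : seq nat :=
  match c with
  | Asg x _ => [:: x]
  | Sto _ _ _ => [::]
  | Seq c1 c2 => wvars c1 ++ wvars c2
  | If _ c1 c2 => wvars c1 ++ wvars c2
  | For i c1 => i :: wvars c1
  | Rd x => [:: x]
  | Pr _ => [::]
  end.

Fixpoint warrs (c : cmd) : seq nat :=
  match c with
  | Sto a _ _ => [:: a]
  | Seq c1 c2 => warrs c1 ++ warrs c2
  | If _ c1 c2 => warrs c1 ++ warrs c2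
  | For i c1 => warrs c1
  | _ => [::]
  end.

Lemma run_var c s x : x \notin wvars c -> var (run c s) x = var s x.
Proof.
elim: c s => [y z|a y z|c1 IH1 c2 IH2|y c1 IH1 c2 IH2|i c IH|y|y] s //=.
- by rewrite inE /upd => /negbTE->.
- by rewrite mem_cat negb_or => /andP[h1 h2]; rewrite IH2 // IH1.
- by rewrite mem_cat negb_or => /andP[h1 h2]; case: ifP => _; [rewrite IH1|rewrite IH2].
- rewrite inE negb_or => /andP[xi h].
  elim: (var s 0) => [|k IHk] /=; first by rewrite /upd (negbTE xi).
  by rewrite {1}/upd (negbTE xi) IH.
- by rewrite inE /upd => /negbTE->.
Qed.

Lemma run_arr c s a : a \notin warrs c -> arr (run c s) a = arr s a.
Proof.
elim: c s => [y z|b y z|c1 IH1 c2 IH2|y c1 IH1 c2 IH2|i c IH|y|y] s //=.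
- by rewrite inE => /negbTE->.
- by rewrite mem_cat negb_or => /andP[h1 h2]; rewrite IH2 // IH1.
- by rewrite mem_cat negb_or => /andP[h1 h2]; case: ifP => _; [rewrite IH1|rewrite IH2].
- by move=> h; elim: (var s 0) => [|k IHk] //=; rewrite IH.
Qed.

(** * Compilation to the random access machine *)

Fixpoint depth (x : expr) : nat :=
  match x with
  | Cst _ | Var _ => 0
  | Arr _ y => (depth y).+1
  | Plus y z | Minus y z => maxn (depth y) (depth z).+1
  end.

Fixpoint wfe (x : expr) : bool :=
  match x with
  | Cst _ => true
  | Var y => y < 32
  | Arr a y => (a < 8) && wfe y
  | Plus y z | Minus y z => wfe y && wfe z
  end.

(** Positivity of assigned variables protects the loop bound in variable 0. Compiled at register
    [d], an expression uses scratch up to [d + depth]; the second one of [Sto] starts at register 1,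
    hence its limit 15. *)
Fixpoint wfc (c : cmd) : bool :=
  match c with
  | Asg x y => [&& 0 < x, x < 32, wfe y & depth y < 16]
  | Sto a y z => [&& a < 8, wfe y, wfe z, depth y < 16 & depth z < 15]
  | Seq c1 c2 => wfc c1 && wfc c2
  | If y c1 c2 => [&& wfe y, depth y < 16, wfc c1 & wfc c2]
  | For i c1 => [&& 0 < i, i < 32, i \notin wvars c1 & wfc c1]
  | Rd x => (0 < x) && (x < 32)
  | Pr y => wfe y && (depth y < 16)
  end.

Lemma wfc_var0 c : wfc c -> 0 \notin wvars c.
Proof.
elim: c => [y z|b y z|c1 IH1 c2 IH2|y c1 IH1 c2 IH2|i c IH|y|y] //=.
- by case/andP; rewrite inE eq_sym; case: y.
- by case/andP=> /IH1 h1 /IH2 h2; rewrite mem_cat negb_or h1.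
- by case/and4P=> _ _ /IH1 h1 /IH2 h2; rewrite mem_cat negb_or h1.
- by case/and4P=> i0 _ _ /IH h; rewrite inE negb_or h eq_sym; case: i i0.
- by case/andP; rewrite inE eq_sym; case: y.
Qed.

Lemma run_var0 c s : wfc c -> var (run c s) 0 = var s 0.
Proof. by move/wfc_var0/run_var. Qed.

(* Registers 0-15 are scratch, variable [x] lives in register [16 + x] and entry
   [i] of array [a] in register [48 + 8 i + a]. *)
Definition vreg x := 16 + x.

(** Copying is adding to 0. Three doublings multiply an index by 8, the stride of the interleaved
    arrays. *)
Fixpoint cexpr (x : expr) (d : nat) : program :=
  match x with
  | Cst c => [:: Const d c]
  | Var y => [:: Const d 0; Add d d (vreg y)]
  | Arr a y => cexpr y d ++
      [:: Add d d d; Add d d d; Add d d d; Const d.+1 (48 + a); Add d d d.+1; Fetch d d]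
  | Plus y z => cexpr y d ++ cexpr z d.+1 ++ [:: Add d d d.+1]
  | Minus y z => cexpr y d ++ cexpr z d.+1 ++ [:: Defs.Sub d d d.+1]
  end.

Definition esize x := size (cexpr x 0).

Lemma size_cexpr x d : size (cexpr x d) = esize x.
Proof.
rewrite /esize; elim: x d => [c|y|a y IH|y IHy z IHz|y IHy z IHz] d //=;
rewrite !size_cat /=; by rewrite ?(IH d) ?(IHy d) ?(IHz d.+1) ?(IHz 1).
Qed.

Fixpoint csize (c : cmd) : nat :=
  match c with
  | Asg _ y => esize y + 2
  | Sto _ y z => esize y + (esize z + 6)
  | Seq c1 c2 => csize c1 + csize c2
  | If y c1 c2 => esize y + (1 + (csize c2 + (2 + csize c1)))
  | For _ c1 => 5 + (csize c1 + 3)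
  | Rd _ => 1
  | Pr y => esize y + 1
  end.

(** [Const 0 1] makes a following [Jpos 0] unconditional. The loop is re-entered at [o.+1], past the
    initialisation of its counter. *)
Fixpoint ccmd (c : cmd) (o : nat) : program :=
  match c with
  | Asg x y => cexpr y 0 ++ [:: Const 1 0; Add (vreg x) 0 1]
  | Sto a y z => cexpr y 0 ++ cexpr z 1 ++
      [:: Add 0 0 0; Add 0 0 0; Add 0 0 0; Const 2 (48 + a); Add 0 0 2; Put 0 1]
  | Seq c1 c2 => ccmd c1 o ++ ccmd c2 (o + csize c1)
  | If y c1 c2 =>
      let o2 := o + esize y + 1 in let o1 := o2 + csize c2 + 2 in
      cexpr y 0 ++ [:: Jpos 0 o1] ++ ccmd c2 o2 ++
      [:: Const 0 1; Jpos 0 (o1 + csize c1)] ++ ccmd c1 o1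
  | For i c1 =>
      [:: Const (vreg i) 0; Defs.Sub 0 (vreg 0) (vreg i); Jpos 0 (o + 5);
          Const 0 1; Jpos 0 (o + 5 + csize c1 + 3)] ++
      ccmd c1 (o + 5) ++ [:: Const 0 1; Add (vreg i) (vreg i) 0; Jpos 0 o.+1]
  | Rd x => [:: Read (vreg x)]
  | Pr y => cexpr y 0 ++ [:: Print 0]
  end.

Lemma size_ccmd c o : size (ccmd c o) = csize c.
Proof.
elim: c o => [y z|b y z|c1 IH1 c2 IH2|y c1 IH1 c2 IH2|i c IH|y|y] o //=;
by rewrite ?size_cat /= ?size_cat /= ?size_cexpr ?IH1 ?IH2 ?IH.
Qed.

(** Both branches of a conditional are added, so that the bound is a polynomial in [n]. *)
Fixpoint steps (c : cmd) (n : nat) : nat :=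
  match c with
  | Asg _ y => esize y + 2
  | Sto _ y z => esize y + esize z + 6
  | Seq c1 c2 => steps c1 n + steps c2 n
  | If y c1 c2 => esize y + 3 + steps c1 n + steps c2 n
  | For _ c1 => 5 + n * (steps c1 n + 5)
  | Rd _ => 1
  | Pr y => esize y + 1
  end.

Definition code_at (P : program) (o : nat) (code : program) :=
  forall i, i < size code -> onth P (o + i) = onth code i.

Lemma code_at_cat P o c1 c2 : code_at P o (c1 ++ c2) ->
  code_at P o c1 /\ code_at P (o + size c1) c2.
Proof.
move=> h; split=> i hi.
  by rewrite h ?size_cat ?ltn_addr // onth_cat hi.
by rewrite -addnA h ?size_cat ?ltn_add2l // onth_cat ltnNge leq_addr /= addKn.
Qed.

Lemma code_at_cons P o i c : code_at P o (i :: c) -> onth P o = Some i /\ code_at P o.+1 c.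
Proof.
move=> h; split; first by have := h 0 isT; rewrite addn0.
by move=> j hj; rewrite addSnnS h.
Qed.

Definition goes (P : program) (c : config) (k : nat) (c' : config) : Prop :=
  iter k (obind (step P)) (Some c) = Some c'.

Lemma goes0 P c : goes P c 0 c.
Proof. by []. Qed.

Lemma goes_add P c1 k1 c2 k2 c3 : goes P c1 k1 c2 -> goes P c2 k2 c3 -> goes P c1 (k1 + k2) c3.
Proof. by rewrite /goes addnC iterD => -> ->. Qed.

Lemma goes_exec P i c k c' : onth P (pc c) = Some i -> goes P (exec i c) k c' -> goes P c k.+1 c'.
Proof. by move=> h; rewrite /goes iterSr /= /step h. Qed.

Definition agree (m : nat -> nat) (s : store) : Prop :=
  (forall x, x < 32 -> m (vreg x) = var s x) /\
  (forall a i, a < 8 -> m (48 + 8 * i + a) = arr s a i).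

Lemma agree_scratch m s d v : d < 16 -> agree m s -> agree (upd m d v) s.
Proof.
move=> hd [hv ha]; split=> [x hx|a i hai]; rewrite /upd.
  by rewrite ifF ?hv //; apply/eqP; rewrite /vreg; lia.
by rewrite ifF ?ha //; apply/eqP; lia.
Qed.

Lemma agree_setv m s x v : x < 32 -> agree m s -> agree (upd m (vreg x) v) (setv s x v).
Proof.
move=> hx [hv ha]; split=> [y hy|a i hai]; rewrite /upd.
  by rewrite {1}/vreg eqn_add2l /= /upd; case: eqP => // _; apply: hv.
by rewrite ifF ?ha //; apply/eqP; rewrite /vreg; lia.
Qed.

Lemma agree_seta m s a i v : a < 8 -> agree m s -> agree (upd m (48 + 8 * i + a) v) (seta s a i v).
Proof.
move=> ha8 [hv ha]; split=> [y hy|b j hb]; rewrite /upd /=.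
  by rewrite ifF ?hv //; apply/eqP; rewrite /vreg; lia.
have [->|ba] := eqVneq b a.
  rewrite /upd; have [->|ij] := eqVneq j i; first by rewrite eqxx.
  by rewrite ifF ?ha //; apply/eqP; move/eqP: ij; lia.
by rewrite ifF ?ha //; apply/eqP; move/eqP: ba; lia.
Qed.

Lemma cexpr_correct x P o d m inp buf outs t s : wfe x -> d + depth x < 16 ->
  code_at P o (cexpr x d) -> agree m s ->
  exists m' t', [/\ goes P (Config o m inp buf outs t) (esize x) (Config (o + esize x) m' inp buf outs t'),
    agree m' s, m' d = ev x s & forall y, y < d -> m' y = m y].
Proof.
rewrite -(size_cexpr x d).
elim: x o d m t => [c|y|a y IH|y IHy z IHz|y IHy z IHz] o d m t /=.
- move=> _ hd /code_at_cons[h _] hm; eexists; eexists; split.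
  + by apply: goes_exec; [exact: h|rewrite /= addn1; exact: goes0].
  + by apply: agree_scratch => //; lia.
  + by rewrite /upd eqxx.
  + by move=> y hy; rewrite /upd ltn_eqF.
- move=> hy hd /code_at_cons[h /code_at_cons[h2 _]] hm; eexists; eexists; split.
  + apply: goes_exec; first exact: h.
    by apply: goes_exec; [exact: h2|rewrite /= addn2; exact: goes0].
  + by do 2 (apply: agree_scratch; first lia).
  + rewrite /upd !eqxx ifF ?(hm.1 _ hy) //; by apply/eqP; rewrite /vreg; lia.
  + by move=> z hz; rewrite /upd ltn_eqF.
- case/andP=> ha8 wy hd /code_at_cat[hc].
  move=> /code_at_cons[h1 /code_at_cons[h2 /code_at_cons[h3 /code_at_cons[h4 /code_at_cons[h5 /code_at_cons[h6 _]]]]]] hm.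
  have [|m1 [t1 [g1 hm1 e1 f1]]] := IH o d m t wy _ hc hm; first by lia.
  eexists; eexists; split.
  + rewrite size_cat; apply: goes_add g1 _ => /=.
    apply: goes_exec; first exact: h1.
    apply: goes_exec; first exact: h2.
    apply: goes_exec; first exact: h3.
    apply: goes_exec; first exact: h4.
    apply: goes_exec; first exact: h5.
    apply: goes_exec; first exact: h6.
    by rewrite addnA !addnS addn0; exact: goes0.
  + by do 6 (apply: agree_scratch; first lia).
  + rewrite /upd !eqxx (_ : d == d.+1 = false); last by apply/eqP; lia.
    rewrite e1 -(hm1.2 _ (ev y s) ha8) !ifF //; try (by apply/eqP; lia).
    by congr (m1 _); lia.
  + by move=> z hz; rewrite /upd !ifF ?f1 //; apply/eqP; lia.
- case/andP=> wy wz hd /code_at_cat[hc1 /code_at_cat[hc2 /code_at_cons[h _]]] hm.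
  have [|m1 [t1 [g1 hm1 e1 f1]]] := IHy o d m t wy _ hc1 hm; first by lia.
  have [|m2 [t2 [g2 hm2 e2 f2]]] := IHz _ d.+1 m1 t1 wz _ hc2 hm1; first by lia.
  eexists; eexists; split.
  + rewrite !size_cat; apply: goes_add g1 _; apply: goes_add g2 _ => /=.
    by apply: goes_exec; [exact: h|rewrite !addnA addn1; exact: goes0].
  + by apply: agree_scratch => //; lia.
  + by rewrite /upd eqxx e2 f2 // e1.
  + by move=> x hx; rewrite /upd ltn_eqF // f2 ?f1 //; lia.
- case/andP=> wy wz hd /code_at_cat[hc1 /code_at_cat[hc2 /code_at_cons[h _]]] hm.
  have [|m1 [t1 [g1 hm1 e1 f1]]] := IHy o d m t wy _ hc1 hm; first by lia.
  have [|m2 [t2 [g2 hm2 e2 f2]]] := IHz _ d.+1 m1 t1 wz _ hc2 hm1; first by lia.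
  eexists; eexists; split.
  + rewrite !size_cat; apply: goes_add g1 _; apply: goes_add g2 _ => /=.
    by apply: goes_exec; [exact: h|rewrite !addnA addn1; exact: goes0].
  + by apply: agree_scratch => //; lia.
  + by rewrite /upd eqxx e2 f2 // e1.
  + by move=> x hx; rewrite /upd ltn_eqF // f2 ?f1 //; lia.
Qed.

Lemma goes_end P p p' m inp buf outs t : p = p' ->
  goes P (Config p m inp buf outs t) 0 (Config p' m inp buf outs t).
Proof. by move->. Qed.

Lemma ccmd_correct c P o m outs t s : wfc c -> code_at P o (ccmd c o) -> agree m s ->
  exists k m' t', [/\ k <= steps c (var s 0),
    goes P (Config o m (rest s) (printed s) outs t) k
      (Config (o + csize c) m' (rest (run c s)) (printed (run c s)) outs t') &
    agree m' (run c s)].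
Proof.
elim: c o m t s => [x y|a y z|c1 IH1 c2 IH2|y c1 IH1 c2 IH2|i c IH|x|y] o m t s /=.
- case/and4P=> x0 x32 wy hd /code_at_cat[hc]; rewrite size_cexpr.
  move=> /code_at_cons[h1 /code_at_cons[h2 _]] hm.
  have [m1 [t1 [g1 hm1 e1 _]]] := @cexpr_correct y P o 0 m (rest s) (printed s) outs t s wy hd hc hm.
  exists (esize y + 2); do 2!eexists; split => //.
    apply: goes_add g1 _; apply: goes_exec; first exact: h1.
    apply: goes_exec; first exact: h2.
    by apply: goes_end; lia.
  by rewrite /upd /= addn0 e1; apply: agree_setv => //; apply: agree_scratch.
- case/and5P=> a8 wy wz hdy hdz /code_at_cat[hc1 /code_at_cat[hc2]]; rewrite !size_cexpr.
  move=> /code_at_cons[h1 /code_at_cons[h2 /code_at_cons[h3 /code_at_cons[h4 /code_at_cons[h5 /code_at_cons[h6 _]]]]]] hm.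
  have [m1 [t1 [g1 hm1 e1 _]]] := @cexpr_correct y P o 0 m (rest s) (printed s) outs t s wy hdy hc1 hm.
  rewrite size_cexpr in hc2.
  have [m2 [t2 [g2 hm2 e2 f2]]] := @cexpr_correct z P (o + esize y) 1 m1 (rest s) (printed s) outs t1 s wz hdz hc2 hm1.
  exists (esize y + esize z + 6); do 2!eexists; split => //.
    apply: goes_add; first exact: goes_add g1 g2.
    do 6 (apply: goes_exec; first (first [exact: h1|exact: h2|exact: h3|exact: h4|exact: h5|exact: h6])).
    by apply: goes_end; lia.
  rewrite /upd /= e2 f2 // e1.
  rewrite (_ : _ + (48 + a) = 48 + 8 * ev y s + a); last by lia.
  by apply: agree_seta => //; do 5 apply: agree_scratch => //.
- case/andP=> w1 w2 /code_at_cat[]; rewrite size_ccmd => hc1 hc2 hm.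
  have [k1 [m1 [t1 [b1 g1 hm1]]]] := IH1 o m t s w1 hc1 hm.
  have [k2 [m2 [t2 [b2 g2 hm2]]]] := IH2 _ m1 t1 _ w2 hc2 hm1.
  exists (k1 + k2), m2, t2; split => //; last by rewrite addnA; apply: goes_add g2.
  by rewrite leq_add // -(run_var0 s w1).
- case/and4P=> wy hd w1 w2 /code_at_cat[hc0]; rewrite size_cexpr.
  move=> /code_at_cons[h1 /code_at_cat[hc2]]; rewrite size_ccmd.
  move=> /code_at_cons[h3 /code_at_cons[h4 hc1]] hm.
  have [m1 [t1 [g1 hm1 e1 _]]] := @cexpr_correct y P o 0 m (rest s) (printed s) outs t s wy hd hc0 hm.
  rewrite -addn1 in hc2 h3 h4 hc1.
  case: ifP => hy.
    have hc1' : code_at P (o + esize y + 1 + csize c2 + 2) (ccmd c1 (o + esize y + 1 + csize c2 + 2)).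
      by move: hc1; rewrite !addn1 addn2.
    have [k2 [m2 [t2 [b2 g2 hm2]]]] := IH1 _ m1 (t1 + bitlen (ev y s)) s w1 hc1' hm1.
    exists (esize y + k2.+1), m2, t2; split => //; first by lia.
    apply: goes_add g1 _; apply: goes_exec; first exact: h1.
    rewrite /= e1 hy; move: g2; congr goes; congr Config; lia.
  have [k2 [m2 [t2 [b2 g2 hm2]]]] := IH2 _ m1 (t1 + bitlen (ev y s)) s w2 hc2 hm1.
  exists (esize y + (1 + (k2 + 2))); do 2!eexists; split; first by lia.
    apply: goes_add g1 _; apply: goes_exec; first exact: h1.
    rewrite /= e1 hy -addn1; apply: goes_add g2 _.
    apply: goes_exec; first exact: h3.
    apply: goes_exec; first exact: h4.
    by rewrite /= /upd /=; apply: goes_end; lia.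
  exact: agree_scratch.
- case/and4P=> i0 i32 iw wc; rewrite -cat_cons -!cat_cons.
  move=> /code_at_cons[h1 /code_at_cons[h2 /code_at_cons[h3 /code_at_cons[h4 /code_at_cons[h5]]]]].
  rewrite (_ : o.+1.+4 = o + 5); last by lia.
  move=> /code_at_cat[hc]; rewrite size_ccmd.
  move=> /code_at_cons[h6 /code_at_cons[h7 /code_at_cons[h8 _]]] hm.
  set f := (fun s' : store => _); set n := var s 0.
  (* Each round has 5 instructions besides the body; the last 4 pay for the failing test and the
     jump out. *)
  have loop j : forall m t s, var s 0 = n -> var s i + j = n -> agree m s ->
    exists k m' t', [/\ k <= j * (steps c n + 5) + 4,
      goes P (Config o.+1 m (rest s) (printed s) outs t) k
        (Config (o + (5 + (csize c + 3))) m' (rest (iter j f s)) (printed (iter j f s)) outs t') &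
      agree m' (iter j f s)].
    elim: j => [|j IHj] {h1 hm} m0 t0 s0 s0n s0i hm0.
      have e0 : m0 (vreg 0) - m0 (vreg i) = 0 by rewrite !hm0.1 // s0n -s0i addn0 subnn.
      exists 4; do 2!eexists; split => //.
        apply: goes_exec; first exact: h2.
        apply: goes_exec; first exact: h3.
        rewrite /= {1}/upd /= e0 /=.
        apply: goes_exec; first exact: h4.
        apply: goes_exec; first exact: h5.
        by rewrite /= {1}/upd /=; apply: goes_end; lia.
      by do 2 apply: agree_scratch => //.
    set mm := upd m0 0 (m0 (vreg 0) - m0 (vreg i)).
    have hmm : agree mm s0 by apply: agree_scratch.
    have pos : 0 < mm 0 by rewrite /mm /upd eqxx !hm0.1 //; lia.
    set t1 := t0 + (bitlen (m0 (vreg 0)) + bitlen (m0 (vreg i))) + bitlen (mm 0).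
    have [k2 [m2 [t2 [b2 g2 hm2]]]] := IH _ mm t1 s0 wc hc hmm.
    have vi : var (run c s0) i = var s0 i by apply: run_var.
    have [|||k3 [m3 [t3 [b3 g3 hm3]]]] := IHj (upd (upd m2 0 1) (vreg i) (m2 (vreg i) + 1))
        (t2 + bitlen 1 + (bitlen (m2 (vreg i)) + bitlen 1) + bitlen 1) (f s0).
    - by rewrite /f /= /upd ifF ?run_var0 //; apply/eqP; lia.
    - by rewrite /f /= /upd eqxx vi addSnnS.
    - rewrite /f addn1 (hm2.1 _ i32); apply: agree_setv => //; exact: agree_scratch.
    rewrite -iterSr in g3 hm3.
    exists (2 + (k2 + (3 + k3))), m3, t3; split => //; first by move: b2; rewrite s0n; lia.
    apply: goes_exec; first exact: h2.
    apply: goes_exec; first exact: h3.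
    rewrite /= -/mm pos; apply: goes_add g2 _.
    apply: goes_exec; first exact: h6.
    apply: goes_exec; first exact: h7.
    apply: goes_exec; first exact: h8.
    rewrite /= /upd /=; move: g3; rewrite /upd /=; congr goes; congr Config; lia.
  have [|||k [m' [t' [b g hm']]]] := loop n (upd m (vreg i) 0) (t + bitlen 0) (setv s i 0).
  - by rewrite /= /upd ifF //; apply/eqP; lia.
  - by rewrite /= /upd eqxx.
  - exact: agree_setv.
  exists k.+1, m', t'; split => //; first by lia.
  by apply: goes_exec; first exact: h1.
- case/andP=> x0 x32 /code_at_cons[h _] hm; exists 1; do 2!eexists; split => //.
    by apply: goes_exec; [exact: h|apply: goes_end; rewrite addn1].
  exact: (agree_setv _ x32 hm).
- case/andP=> wy hd /code_at_cat[hc]; rewrite size_cexpr => /code_at_cons[h _] hm.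
  have [m1 [t1 [g1 hm1 e1 _]]] := @cexpr_correct y P o 0 m (rest s) (printed s) outs t s wy hd hc hm.
  exists (esize y + 1); do 2!eexists; split => //.
    apply: goes_add g1 _; apply: goes_exec; first exact: h.
    by rewrite /= e1; apply: goes_end; lia.
  by case: hm1.
Qed.

(** * Resource bounds *)

Definition bounded (M : nat) (m : nat -> nat) : Prop :=
  forall a, m a <= M /\ (m a != 0 -> a <= M).

Definition ibound (i : instr) : nat :=
  match i with
  | Const i v => maxn i v
  | Add i _ _ | Defs.Sub i _ _ | Fetch i _ | Read i => i
  | _ => 0
  end.

Lemma bounded_upd M m a v : bounded M m -> a <= M -> v <= M -> bounded M (upd m a v).
Proof. by move=> h ha hv b; rewrite /upd; case: eqP => [->|_] //; apply: h. Qed.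

Lemma bounded_mono M M' m : M <= M' -> bounded M m -> bounded M' m.
Proof.
move=> h hm a; have [h1 h2] := hm a; split; first exact: leq_trans h1 h.
by move=> /h2 h3; apply: leq_trans h3 h.
Qed.

Lemma exec_bounded M i c : ibound i <= M -> all (leq^~ M) (inp c) -> bounded M (Defs.mem c) ->
  bounded (2 * M) (Defs.mem (exec i c)).
Proof.
case: c => p m s b o t /= hi hs hm.
have hm2 : bounded (2 * M) m by apply: bounded_mono hm; lia.
have hhead : head 0 s <= M by case: s hs => //= x s /andP[].
have hv a : m a <= M by have [] := hm a.
case: i hi => [i v|i j k|i j k|i j|i j|i l|i|i|] /= hi //; apply: bounded_upd => //;
  try lia.
- by have := hv j; have := hv k; lia.
- by have := hv j; have := hv k; lia.
- by have := hv (m j); lia.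
- by have := hv i; lia.
- by have := hv j; lia.
Qed.

Lemma leq_bitlen a b : a <= b -> bitlen a <= bitlen b.
Proof. by move=> h; rewrite /bitlen ltnS leq_trunc_log. Qed.

Lemma bitlen_exp2 b : bitlen (2 ^ b) = b.+1.
Proof. by rewrite /bitlen trunc_expnK. Qed.

Lemma cost_bounded B i c : ibound i <= 2 ^ B -> all (leq^~ (2 ^ B)) (inp c) ->
  bounded (2 ^ B) (Defs.mem c) -> cost i c <= 2 * B.+1.
Proof.
case: c => p m s b o t /= hi hs hm.
have hb x : x <= 2 ^ B -> bitlen x <= B.+1 by move/leq_bitlen; rewrite bitlen_exp2.
have hhead : head 0 s <= 2 ^ B by case: s hs => //= x s /andP[].
have hv a : bitlen (m a) <= B.+1 by apply: hb; have [] := hm a.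
case: i hi => [i v|i j k|i j k|i j|i j|i l|i|i|] /= hi; rewrite /cost /= ?mul2n -?addnn;
  try (by apply: leq_add); try (by apply: (@leq_trans B.+1); [|exact: leq_addr]).
- by apply: (@leq_trans B.+1); [apply: hb; move: hi; rewrite geq_max => /andP[]|exact: leq_addr].
- by apply: (@leq_trans B.+1); [apply: hb|exact: leq_addr].
Qed.

Lemma goesSP P c k c' : goes P c k.+1 c' <->
  exists2 i, onth P (pc c) = Some i & goes P (exec i c) k c'.
Proof.
rewrite /goes iterSr /= /step; split; last by case=> i ->.
case: (onth P (pc c)) => [i|] /=; first by exists i.
suff -> : forall f, iter k (@obind config config f) None = None by [].
by move=> f; elim: k => //= k ->.
Qed.

(** One doubling per instruction is one more bit per instruction, so under logarithmic cost [k]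
    instructions take time at most quadratic in [b + k]. *)
Lemma goes_bounded P k c c' b : goes P c k c' ->
  (forall i j, onth P j = Some i -> ibound i <= 2 ^ b) ->
  all (leq^~ (2 ^ b)) (inp c) -> bounded (2 ^ b) (Defs.mem c) ->
  bounded (2 ^ (b + k)) (Defs.mem c') /\
  clock c <= clock c' <= clock c + k * (2 * (b + k).+1).
Proof.
elim: k c b => [|k IH] c b.
  by case=> <- _ _ h; rewrite !addn0 leqnn.
case/goesSP => i hi g hP hs hm.
have [|||h1 h2] := IH (exec i c) b.+1 g.
- by move=> j l hj; apply: leq_trans (hP _ _ hj) _; rewrite leq_exp2l.
- have hs' : all (leq^~ (2 ^ b)) (inp (exec i c)).
    by case: c hs {hi g hm} => p m s bb o t /=; case: i => //= x; case: s => //= y s /andP[].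
  by apply: sub_all hs' => x /= hx; apply: leq_trans hx _; rewrite leq_exp2l.
- by rewrite expnS; apply: exec_bounded => //; apply: hP hi.
rewrite addSnnS in h1 h2; split => //.
have hc := cost_bounded (hP _ _ hi) hs hm.
have hcl : clock (exec i c) = clock c + cost i c by case: c {hi g hs hm hc h2} => *; case: i.
move: h2; rewrite hcl; move: (cost i c) (clock c) (clock c') hc => x y z.
by rewrite mulSn; lia.
Qed.

(** There are [2 ^ B + 1] addresses with at most [2 * B.+1] bits each, and both factors are at most
    [2 * 2 ^ B]. *)
Lemma bounded_space B m : bounded (2 ^ B) m ->
  exists2 A : seq nat, (forall a, m a != 0 -> a \in A) &
    \sum_(a <- A) (bitlen a + bitlen (m a)) <= 2 ^ (2 * B + 2).
Proof.
move=> hm; exists (iota 0 (2 ^ B).+1).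
  by move=> a /(hm a).2; rewrite mem_iota.
have hB x : x <= 2 ^ B -> bitlen x <= B.+1 by move/leq_bitlen; rewrite bitlen_exp2.
apply: (@leq_trans (\sum_(a <- iota 0 (2 ^ B).+1) (2 * B.+1))).
  rewrite [leqLHS]big_seq [leqRHS]big_seq; apply: leq_sum => a; rewrite mem_iota /= ltnS => ha.
  by rewrite mul2n -addnn leq_add // hB // (hm a).1.
rewrite big_const_seq count_predT size_iota iter_addn_0.
have h1 : B.+1 <= 2 ^ B by apply: ltn_expl.
have h2 : 0 < 2 ^ B by rewrite expn_gt0.
apply: (@leq_trans ((2 * 2 ^ B) * (2 * 2 ^ B))); first by apply: leq_mul; lia.
by rewrite -expnS -expnD leq_exp2l //; lia.
Qed.

Fixpoint steps_poly (c : cmd) : {poly nat} :=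
  (match c with
  | Asg _ y => (esize y + 2)%:P
  | Sto _ y z => (esize y + esize z + 6)%:P
  | Seq c1 c2 => steps_poly c1 + steps_poly c2
  | If y c1 c2 => (esize y + 3)%:P + steps_poly c1 + steps_poly c2
  | For _ c1 => 5%N%:P + 'X * (steps_poly c1 + 5%N%:P)
  | Rd _ => 1%N%:P
  | Pr y => (esize y + 1)%:P
  end)%R.

Lemma horner_steps_poly c n : (steps_poly c).[n]%R = steps c n.
Proof.
elim: c => [y z|b y z|c1 IH1 c2 IH2|y c1 IH1 c2 IH2|i c IH|y|y] /=;
  rewrite ?(hornerD, hornerM, hornerX, hornerC) ?IH1 ?IH2 ?IH //.
Qed.

Lemma horner_nat_mono (p : {poly nat}) m n : m <= n -> p.[m]%R <= p.[n]%R.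
Proof.
move=> mn; rewrite !horner_coef; apply: leq_sum => i _.
rewrite !natrXE; apply: leq_mul => //; have [-> //|i0] := posnP i.
by rewrite leq_exp2r.
Qed.

(** * The output loop *)

(** The store invariant says nothing about scratch registers. Clearing them lets [goes_bounded]
    start again from [2 ^ b] in each round. *)
Definition clear_scratch : program := mkseq (Const^~ 0) 16.

Lemma goes_clear P o m inp buf outs t s : code_at P o clear_scratch -> agree m s ->
  exists m' t', [/\ goes P (Config o m inp buf outs t) 16 (Config (o + 16) m' inp buf outs t'),
    agree m' s & forall a, a < 16 -> m' a = 0].
Proof.
move=> h hm.
suff /(_ 16 (leqnn 16)) : forall j, j <= 16 -> exists m' t',
    [/\ goes P (Config o m inp buf outs t) j (Config (o + j) m' inp buf outs t'),
    agree m' s & forall a, a < j -> m' a = 0] by [].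
elim=> [|j IH] hj; first by exists m, t; rewrite addn0.
have [m1 [t1 [g hm1 e1]]] := IH (ltnW hj).
exists (upd m1 j 0), (t1 + bitlen 0); split.
- rewrite -[j.+1]addn1; apply: goes_add g _; apply: (@goes_exec _ (Const j 0)).
    rewrite h ?size_mkseq //; move: hj; clear.
    by do 16 (case: j => [//|j]).
  by apply: goes_end; rewrite addn1 addnS.
- by apply: agree_scratch.
- move=> a; rewrite ltnS leq_eqVlt /upd => /orP[->//|ha]; by rewrite e1 // if_same.
Qed.

Definition store_bounded (b : nat) (s : store) : Prop :=
  (forall x, x < 32 -> var s x <= 2 ^ b) /\
  (forall a i, a < 8 -> arr s a i <= 2 ^ b /\ (arr s a i != 0 -> 48 + 8 * i + a <= 2 ^ b)).

Lemma agree_bounded b m s : 6 <= b -> agree m s -> (forall a, a < 16 -> m a <= 1) ->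
  store_bounded b s -> bounded (2 ^ b) m.
Proof.
move=> b6 [hv ha] hs [sv sa] a.
have p64 : 64 <= 2 ^ b by apply: (@leq_trans (2 ^ 6)) => //; rewrite leq_exp2l.
have [a16|a16] := ltnP a 16.
  by split; [apply: (@leq_trans 1); [apply: hs|lia]|lia].
have [a48|a48] := ltnP a 48.
  split; last by lia.
  have -> : a = vreg (a - 16) by rewrite /vreg; lia.
  by rewrite hv ?sv //; lia.
have E : a = 48 + 8 * ((a - 48) %/ 8) + (a - 48) %% 8.
  by rewrite -addnA [8 * _]mulnC -divn_eq; lia.
have h8 : (a - 48) %% 8 < 8 by rewrite ltn_mod.
by rewrite [in m a]E [in a <= _]E ha //; apply: sa.
Qed.

Section Driver.
Variables (cinit cpop cnbr : cmd) (top : nat).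

Definition dloop := csize cinit + 20.
Definition demit := dloop + csize cpop.
Definition dclear := demit.+1 + csize cnbr.
Definition dend := dclear + 17.

Definition driver : program :=
  [:: Read (vreg 0)] ++ ccmd cinit 1 ++ clear_scratch ++
  [:: Jpos (vreg top) dloop; Const 0 1; Jpos 0 dend] ++
  ccmd cpop dloop ++ [:: Emit] ++ ccmd cnbr demit.+1 ++ clear_scratch ++
  [:: Jpos (vreg top) dloop].

Lemma size_driver : size driver = dend.
Proof.
by rewrite !size_cat /= !size_ccmd /dend /dclear /demit /dloop; lia.
Qed.

(** Of the 38 instructions, 20 surround [cinit] (one [Read], 16 to clear, at most 3 to branch) and
    18 belong to a round (one [Emit], 16 to clear, one jump). *)
Definition dsteps n := steps cinit n + steps cpop n + steps cnbr n + 38.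

Hypotheses (wfi : wfc cinit) (wfp : wfc cpop) (wfn : wfc cnbr) (top32 : top < 32).

Definition flush (s : store) := Store (var s) (arr s) (rest s) [::].

Variables (I : seq (seq nat) -> store -> Prop) (n b N : nat) (inp0 : seq nat) (Lst : seq (seq nat)).
Hypotheses (b6 : 6 <= b) (hP : forall i j, onth driver j = Some i -> ibound i <= 2 ^ b).
Hypothesis hinp : all (leq^~ (2 ^ b)) (n :: inp0).
Hypothesis Iinit : I [::] (run cinit (Store (upd (fun=> 0) 0 n) (fun _ _ => 0) inp0 [::])).
Hypothesis Isafe : forall os s, I os s ->
  [/\ var s 0 = n, rest s = [::], printed s = [::] & store_bounded b s].
Hypothesis Inext : forall os s, I os s -> 0 < var s top ->
  let s1 := run cpop s in rest s1 = [::] /\ I (rcons os (printed s1)) (run cnbr (flush s1)).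
Hypothesis Isize : forall os s, I os s -> size os <= N.
Hypothesis Idone : forall os s, I os s -> var s top = 0 -> perm_eq os Lst.

Let T := dsteps n.
Let B := b + T.
Let Delta := T * (2 * B.+1).

Lemma segment k c c' : goes driver c k c' -> k <= T -> all (leq^~ (2 ^ b)) (inp c) ->
  bounded (2 ^ b) (Defs.mem c) ->
  bounded (2 ^ B) (Defs.mem c') /\ clock c <= clock c' <= clock c + Delta.
Proof.
move=> g kT hi hm; have [h1 /andP[h2 h3]] := goes_bounded g hP hi hm; split.
  by apply: bounded_mono h1; rewrite leq_exp2l // leq_add2l.
rewrite h2 (leq_trans h3) // leq_add2l leq_mul // leq_mul2l ltnS leq_add2l kT; by [].
Qed.

Let dpc s := if 0 < var s top then dloop else dend.

Lemma driver_codes :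
  [/\ onth driver 0 = Some (Read (vreg 0)), code_at driver 1 (ccmd cinit 1),
      code_at driver (1 + csize cinit) clear_scratch,
      code_at driver (csize cinit + 17) [:: Jpos (vreg top) dloop; Const 0 1; Jpos 0 dend] &
      code_at driver dloop (ccmd cpop dloop)] /\
  [/\ onth driver demit = Some Emit, code_at driver demit.+1 (ccmd cnbr demit.+1),
      code_at driver dclear clear_scratch & onth driver (dclear + 16) = Some (Jpos (vreg top) dloop)].
Proof.
have h0 : code_at driver 0 driver by move=> i _; rewrite add0n.
have /code_at_cons[i0 /code_at_cat[i1]] := h0; rewrite size_ccmd.
move=> /code_at_cat[i2]; rewrite size_mkseq => /code_at_cat[i3].
rewrite (_ : 1 + csize cinit + 16 + _ = dloop); last by rewrite /dloop /=; lia.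
move=> /code_at_cat[i4]; rewrite size_ccmd => /code_at_cons[i5 /code_at_cat[i6]].
rewrite size_ccmd => /code_at_cat[i7]; rewrite size_mkseq => /code_at_cons[i8 _].
split; split => //; by rewrite (_ : csize cinit + 17 = 1 + csize cinit + 16) //; lia.
Qed.

Lemma driver_body os s m outs t : I os s -> agree m s -> (forall a, a < 16 -> m a <= 1) ->
  0 < var s top ->
  exists k m' t' te s2, [/\ I (rcons os (printed (run cpop s))) s2, k <= T,
    goes driver (Config dloop m [::] [::] outs t) k
      (Config (dpc s2) m' [::] [::] (rcons outs (te, printed (run cpop s))) t'),
    agree m' s2 /\ (forall a, a < 16 -> m' a <= 1) & t <= te <= t + Delta /\ t' <= te + Delta].
Proof.
move=> Is hm hs stop; have [s0 srest sprint sb] := Isafe Is.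
have [r1 I2] := Inext Is stop; set s1 := run cpop s in r1 I2 *.
set s2 := run cnbr _ in I2; have [s20 srest2 sprint2 _] := Isafe I2.
have [_ [cE cN cC cJ]] := driver_codes; have [[_ _ _ _ cP] _] := driver_codes.
have bm : bounded (2 ^ b) m by apply: (agree_bounded b6 hm).
have [k1 [m1 [t1 [b1 g1 hm1]]]] := ccmd_correct outs t wfp cP hm.
rewrite srest sprint -/s1 r1 in g1.
set outs' := rcons outs (t1 + 1, printed s1).
have [k2 [m2 [t2 [b2 g2 hm2]]]] := @ccmd_correct cnbr driver demit.+1 m1 outs' (t1 + 1) (flush s1) wfn cN hm1.
rewrite -/s2 /= r1 srest2 sprint2 in g2.
have [m3 [t3 [g3 hm3 e3]]] := goes_clear [::] [::] outs' t2 cC hm2.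
have g12 : goes driver (Config dloop m [::] [::] outs t) (k1 + 1) (Config demit.+1 m1 [::] [::] outs' (t1 + 1)).
  by apply: goes_add g1 _; apply: goes_exec; [exact: cE|exact: goes_end].
have g4 : goes driver (Config (dclear + 16) m3 [::] [::] outs' t3) 1
    (Config (dpc s2) m3 [::] [::] outs' (t3 + bitlen (m3 (vreg top)))).
  apply: goes_exec; first exact: cJ.
  apply: goes_end; rewrite /= hm3.1 // /dpc /dend.
  by case: ifP => // _; lia.
have gall : goes driver (Config dloop m [::] [::] outs t) (k1 + 1 + k2 + 16 + 1)
    (Config (dpc s2) m3 [::] [::] outs' (t3 + bitlen (m3 (vreg top)))).
  exact: goes_add (goes_add (goes_add g12 g2) g3) g4.
have v1 : var (flush s1) 0 = n by rewrite /= run_var0 // s0.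
have kT : k1 + 1 + k2 + 16 + 1 <= T.
  by rewrite /T /dsteps; move: b1 b2; rewrite s0 v1; lia.
have kT1 : k1 + 1 <= T by apply: leq_trans kT; lia.
have [_ /= /andP[h0 h1]] := segment g12 kT1 isT bm.
have [_ /= /andP[_ h2]] := segment gall kT isT bm.
do 5!eexists; split; [exact: I2|exact: kT|exact: gall|split => //|].
  by move=> a /e3 ->.
by rewrite h0 h1; split => //; apply: leq_trans h2 _; rewrite leq_add2r.
Qed.

Definition completes c0 : Prop :=
  (exists c k, [/\ goes driver c0 k c, step driver c = None,
     perm_eq [seq o.2 | o <- Defs.outs c] Lst &
     path [rel t1 t2 | t2 <= t1 + 2 * Delta] 0 (rcons [seq o.1 | o <- Defs.outs c] (clock c))]) /\
  (forall k c, goes driver c0 k c -> bounded (2 ^ B) (Defs.mem c)).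

Lemma driver_halt os s m outs t : I os s -> bounded (2 ^ B) m -> [seq o.2 | o <- outs] = os ->
  path [rel t1 t2 | t2 <= t1 + 2 * Delta] 0 [seq o.1 | o <- outs] ->
  t <= last 0 [seq o.1 | o <- outs] + Delta -> var s top = 0 ->
  completes (Config dend m [::] [::] outs t).
Proof.
move=> Is bm ho hpath ht stop.
have no : onth driver dend = None by apply: onth_default; rewrite size_driver.
split.
  exists (Config dend m [::] [::] outs t), 0; split; first exact: goes0.
  - by rewrite /step [onth _ _]no.
  - by rewrite ho; apply: Idone stop.
  - by rewrite rcons_path hpath /= (leq_trans ht) // leq_add2l leq_pmull.
by case=> [|k] c; [case=> <-|case/goesSP => i; rewrite [onth _ _]no].
Qed.

(** [j] counts the outputs still possible. The gap between two outputs consists of the end of one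
    round and the beginning of the next, each within [Delta]. *)
Lemma driver_loop j os s m outs t : N <= size os + j -> I os s -> agree m s ->
  (forall a, a < 16 -> m a <= 1) -> [seq o.2 | o <- outs] = os ->
  path [rel t1 t2 | t2 <= t1 + 2 * Delta] 0 [seq o.1 | o <- outs] ->
  t <= last 0 [seq o.1 | o <- outs] + Delta ->
  completes (Config (dpc s) m [::] [::] outs t).
Proof.
elim: j os s m outs t => [|j IH] os s m outs t hN Is hm hs ho hpath ht;
  have [s0 srest sprint sb] := Isafe Is;
  have bm : bounded (2 ^ b) m by [apply: (agree_bounded b6 hm)];
  have bm' : bounded (2 ^ B) m by [apply: bounded_mono bm; rewrite leq_exp2l // leq_addr].
all: have [stop|stop] := posnP (var s top); first by rewrite /dpc stop; apply: (driver_halt Is).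
all: have [k [m' [t' [te [s2 [I2 kT g [hm' hs'] [/andP[te1 te2] te3]]]]]]] := driver_body outs t Is hm hs stop.
  by have := Isize I2; rewrite size_rcons ltnNge => /negP[]; move: hN; rewrite addn0.
have cE : dpc s = dloop by rewrite /dpc stop.
have [||||[c [k' [g' h1 h2 h3]]] h4] := IH _ s2 m' (rcons outs (te, printed (run cpop s))) t' _ I2 hm' hs'.
- by rewrite size_rcons addSnnS.
- by rewrite map_rcons ho.
- by rewrite map_rcons rcons_path hpath /=; apply: leq_trans te2 _; lia.
- by rewrite map_rcons last_rcons.
split; first by exists c, (k + k'); split => //; rewrite cE; apply: goes_add g'.
move=> k0 c1; rewrite cE => g1; have [kk|kk] := leqP k0 k.
  by have [] := segment g1 (leq_trans kk kT) isT bm.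
apply: (h4 (k0 - k)); move: g1; rewrite /goes -{1}(subnK (ltnW kk)) iterD.
by rewrite [iter k _ _]g.
Qed.

Theorem driver_correct :
  enumerates_with_delay driver (n :: inp0) Lst (2 * Delta) /\
  runs_in_space driver (n :: inp0) (2 ^ (2 * B + 2)).
Proof.
have [[c0 c1 c2 c3 _] _] := driver_codes.
pose s0 := Store (upd (fun=> 0) 0 n) (fun _ _ => 0) inp0 [::].
pose s := run cinit s0; have Is : I [::] s := Iinit.
have [sn srest sprint _] := Isafe Is.
set m0 := upd (fun=> 0) (vreg 0) n.
have hm0 : agree m0 s0.
  split=> [x x32|a i a8] /=; first by rewrite /m0 /upd /vreg eqn_add2l.
  by rewrite /m0 /upd /vreg; case: eqP => //; lia.
have [k1 [m1 [t1 [b1 g1 hm1]]]] := @ccmd_correct cinit driver 1 m0 [::] (0 + bitlen n) s0 wfi c1 hm0.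
rewrite -/s srest sprint /= in g1.
have [m2 [t2 [g2 hm2 e2]]] := goes_clear [::] [::] [::] t1 c2 hm1.
have gi : goes driver (init (n :: inp0)) (1 + k1 + 16)
    (Config (csize cinit + 17) m2 [::] [::] [::] t2).
  apply: goes_add; last by move: g2; congr goes; congr Config; lia.
  apply: goes_exec; first exact: c0.
  exact: g1.
have /code_at_cons[j0 /code_at_cons[j1 /code_at_cons[j2 _]]] := c3.
have [k [m3 [t3 [kb gk hm3 e3]]]] : exists k m3 t3, [/\ k <= 3,
    goes driver (Config (csize cinit + 17) m2 [::] [::] [::] t2) k (Config (dpc s) m3 [::] [::] [::] t3),
    agree m3 s & forall a, a < 16 -> m3 a <= 1].
  rewrite /dpc; case: ifP => stop.
    exists 1; do 2!eexists; split => //.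
    + apply: goes_exec; first exact: j0.
      by apply: goes_end; rewrite /= hm2.1 // stop.
    + exact: hm2.
    + by move=> a /e2 ->.
  (* The jump to the end leaves 1 in register 0, hence the bound [<= 1] on scratch registers. *)
  exists 3; do 2!eexists; split => //.
  + apply: goes_exec; first exact: j0.
    rewrite /= hm2.1 // stop; apply: goes_exec; first exact: j1.
    by apply: goes_exec; [exact: j2|apply: goes_end].
  + exact: agree_scratch.
  + by move=> a a16; rewrite /upd; case: eqP => // _; rewrite e2.
have g := goes_add gi gk.
have kT : 1 + k1 + 16 + k <= T.
  by rewrite /T /dsteps; move: b1; rewrite /= /upd /=; lia.
have b0 : bounded (2 ^ b) (Defs.mem (init (n :: inp0))) by [].
have [bm3 /= ht] := segment g kT hinp b0.
have [||||[c [k' [g' h1 h2 h3]]] h4] := @driver_loop N [::] s m3 [::] t3 _ Is hm3 e3 => //.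
split; first by exists c; split => //; exists (1 + k1 + 16 + k + k'); apply: goes_add g'.
move=> c' [k0 g0]; apply: bounded_space; have [kk|kk] := leqP k0 (1 + k1 + 16 + k).
  by have [] := segment g0 (leq_trans kk kT) hinp b0.
apply: (h4 (k0 - (1 + k1 + 16 + k))); move: g0; rewrite -{1}(subnK (ltnW kk)) iterD.
by rewrite [X in iter _ _ X]g.
Qed.

End Driver.

(** * The enumeration algorithm *)

Lemma run_for (Inv : nat -> store -> Prop) i c s :
  0 < i -> i \notin wvars c -> 0 \notin wvars c -> Inv 0 (setv s i 0) ->
  (forall k s', k < var s 0 -> var s' i = k -> var s' 0 = var s 0 -> Inv k s' ->
     Inv k.+1 (setv (run c s') i k.+1)) ->
  Inv (var s 0) (run (For i c) s).
Proof.
move=> i0 ic c0 I0 IS /=; set f := (fun s' : store => _).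
suff /(_ (var s 0) (leqnn _)) : forall k, k <= var s 0 ->
  [/\ Inv k (iter k f (setv s i 0)), var (iter k f (setv s i 0)) i = k &
      var (iter k f (setv s i 0)) 0 = var s 0] by case.
elim=> [|k IH] hk; first by split => //=; rewrite /upd ?eqxx // ifF //; apply/eqP; lia.
have [h1 h2 h3] := IH (ltnW hk); rewrite iterS.
have E : f (iter k f (setv s i 0)) = setv (run c (iter k f (setv s i 0))) i k.+1.
  by rewrite /f run_var // h2.
rewrite E; split; first exact: IS.
  by rewrite /= /upd eqxx.
by rewrite /= /upd ifF ?run_var //; apply/eqP; lia.
Qed.

Lemma run_seq c1 c2 s : run (Seq c1 c2) s = run c2 (run c1 s).
Proof. by []. Qed.

Lemma run_asg x y s : run (Asg x y) s = setv s x (ev y s).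
Proof. by []. Qed.

Lemma run_if y c1 c2 s : run (If y c1 c2) s = if 0 < ev y s then run c1 s else run c2 s.
Proof. by []. Qed.

Fixpoint reads (c : cmd) : bool :=
  match c with
  | Seq c1 c2 | If _ c1 c2 => reads c1 || reads c2
  | For _ c1 => reads c1
  | Rd _ => true
  | _ => false
  end.

Fixpoint prints (c : cmd) : bool :=
  match c with
  | Seq c1 c2 | If _ c1 c2 => prints c1 || prints c2
  | For _ c1 => prints c1
  | Pr _ => true
  | _ => false
  end.

Lemma run_rest c s : ~~ reads c -> rest (run c s) = rest s.
Proof.
elim: c s => [y z|b y z|c1 IH1 c2 IH2|y c1 IH1 c2 IH2|i c IH|y|y] s //=.
- by rewrite negb_or => /andP[h1 h2]; rewrite IH2 // IH1.
- by rewrite negb_or => /andP[h1 h2]; case: ifP => _; [apply: IH1|apply: IH2].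
- by move=> h; elim: (var s 0) => [|k IHk] //=; rewrite IH.
Qed.

Lemma run_printed c s : ~~ prints c -> printed (run c s) = printed s.
Proof.
elim: c s => [y z|b y z|c1 IH1 c2 IH2|y c1 IH1 c2 IH2|i c IH|y|y] s //=.
- by rewrite negb_or => /andP[h1 h2]; rewrite IH2 // IH1.
- by rewrite negb_or => /andP[h1 h2]; case: ifP => _; [apply: IH1|apply: IH2].
- by move=> h; elim: (var s 0) => [|k IHk] //=; rewrite IH.
Qed.

(* Array [a] is only ever set to 0 or 1, and only at loop counters. *)
Fixpoint bitsafe (a : nat) (G : seq nat) (c : cmd) : bool :=
  match c with
  | Sto b (Var x) (Cst v) => (b != a) || ((x \in G) && (v <= 1))
  | Sto b _ _ => b != a
  | Seq c1 c2 | If _ c1 c2 => bitsafe a G c1 && bitsafe a G c2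
  | For i c1 => bitsafe a (i :: G) c1
  | _ => true
  end.

Definition bit_array (K : nat) (f : nat -> nat) : Prop :=
  forall i, f i <= 1 /\ (f i != 0 -> i < K).

(** The memory bound for bit arrays is read off the program text: inside its loop a counter is below
    variable 0, so only small indices are ever written. *)
Lemma bitsafe_run a K c G s : wfc c -> bitsafe a G c -> var s 0 <= K ->
  (forall x, x \in G -> x \notin wvars c /\ var s x < var s 0) ->
  bit_array K (arr s a) -> bit_array K (arr (run c s) a).
Proof.
elim: c G s => [y z|b y z|c1 IH1 c2 IH2|y c1 IH1 c2 IH2|i c IH|y|y] G s //=.
- move=> _ hs hK hG hP; case: (eqVneq a b) => // ab.
  case: y z hs => // x [] // v; rewrite ab eqxx //= => /andP[xG v1] j; rewrite /upd.
  case: eqP => [->|_]; last by rewrite -ab; apply: hP.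
  by split => // _; apply: leq_trans hK; have [] := hG x xG.
- case/andP=> w1 w2 /andP[s1 s2] hK hG hP.
  have h0 : var (run c1 s) 0 = var s 0 by apply: run_var0.
  apply: (IH2 G) => //; rewrite ?h0 //.
    move=> x /hG[]; rewrite mem_cat negb_or => /andP[x1 x2] hx; by rewrite run_var.
  apply: (IH1 G) => // x /hG[]; by rewrite mem_cat negb_or => /andP[x1 x2] hx.
- case/and4P=> _ _ w1 w2 /andP[s1 s2] hK hG hP.
  case: ifP => _; [apply: (IH1 G) => //|apply: (IH2 G) => //] => x /hG[];
    by rewrite mem_cat negb_or => /andP[x1 x2] hx.
- case/and4P=> i0 i32 ic wc hs hK hG hP.
  pose Inv (k : nat) s' := bit_array K (arr s' a) /\ forall x, x \in G -> var s' x = var s x.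
  suff [] : Inv (var s 0) (run (For i c) s) by [].
  have Gi x : x \in G -> x != i by move=> /hG[]; rewrite inE negb_or => /andP[].
  apply: run_for => //; first exact: wfc_var0.
    by split => // x /Gi xi; rewrite /= /upd (negbTE xi).
  move=> k s' kn s'i s'0 [h1 h2]; split.
    apply: (IH (i :: G)) => //; first by rewrite s'0.
    move=> x; rewrite inE => /orP[/eqP->|xG]; first by rewrite s'i s'0.
    have [] := hG x xG; rewrite inE negb_or => /andP[_ xc] hx; by rewrite h2 // s'0.
  move=> x xG; rewrite /= /upd (negbTE (Gi x xG)) run_var ?h2 //.
  by have [] := hG x xG; rewrite inE negb_or => /andP[_].
Qed.

(** * Routines of the enumeration *)

Definition skip := Asg 15 (Cst 0).
(** Indicator of equality: the inner sum is the absolute difference. *)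
Definition same x y := Minus (Cst 1) (Plus (Minus x y) (Minus y x)).
Definition setbit a i x := If x (Sto a (Var i) (Cst 1)) (Sto a (Var i) (Cst 0)).

(* variables: 0 [n], 1 root, 2 stack top, 3 [2 ^ n], 4 code, 5-8, 11-13 loop counters,
   9 matrix index, 10 test result, 14 input word, 15 dummy;
   arrays: 0 adjacency matrix, 1 terminals, 2 current solution, 3 candidate,
   4 component of the root, 5 the set in which it is computed, 6 dictionary *)
Definition cmatrix body := Seq (Asg 9 (Cst 0)) (For 7 (For 8 (Seq body (Asg 9 (Plus (Var 9) (Cst 1)))))).

(** Three bits minus 2 are positive exactly when all of them are 1. *)
Definition csweep := cmatrix
  (If (Minus (Plus (Plus (Arr 4 (Var 7)) (Arr 5 (Var 8))) (Arr 0 (Var 9))) (Cst 2))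
     (Sto 4 (Var 8) (Cst 1)) skip).

Definition creach := Seq
  (For 5 (setbit 4 5 (Minus (Arr 5 (Var 5)) (Plus (Minus (Var 5) (Var 1)) (Minus (Var 1) (Var 5))))))
  (For 6 csweep).

Definition ctest := Seq (Asg 10 (Cst 1))
  (For 5 (If (Minus (Arr 1 (Var 5)) (Arr 4 (Var 5))) (Asg 10 (Cst 0)) skip)).

Definition cdel a u := For 5 (setbit 5 5 (Minus (Arr a (Var 5)) (same (Var 5) (Var u)))).

Definition cmin := For 13 (Seq (cdel 3 13) (Seq creach (Seq ctest
  (If (Var 10) (Sto 3 (Var 13) (Cst 0)) skip)))).

Definition ccode := Seq (Asg 4 (Cst 0)) (For 5 (Asg 4 (Plus (Plus (Var 4) (Var 4)) (Arr 3 (Var 5))))).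

Definition cpush := Seq ccode (If (Minus (Cst 1) (Arr 6 (Var 4)))
  (Seq (Sto 6 (Var 4) (Plus (Var 2) (Cst 1))) (Asg 2 (Plus (Var 4) (Cst 1)))) skip).

Definition ctry := Seq (For 5 (setbit 5 5 (Arr 3 (Var 5)))) (Seq creach (Seq ctest
  (If (Var 10) (Seq cmin cpush) skip))).

Definition creroute := Seq (cdel 2 11) (Seq creach (Seq
  (For 5 (setbit 3 5 (Cst 1))) (Seq (cmatrix
    (If (Minus (Minus (Plus (Arr 4 (Var 7)) (Arr 0 (Var 9))) (Cst 1)) (Arr 4 (Var 8)))
      (Sto 3 (Var 8) (Cst 0)) skip))
  (For 5 (If (same (Var 5) (Var 12)) (Sto 3 (Var 5) (Cst 1)) skip))))).

(** Variables 4 to 14; the final [skip] clears 15. This restores the size bound on variables after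
    each round. *)
Definition creset := foldr (fun x => Seq (Asg x (Cst 0))) skip (iota 4 11).

(** The root becomes the last terminal read, and the first solution is obtained by minimising the
    whole vertex set. *)
Definition cinit :=
  Seq (cmatrix (Seq (Rd 14) (If (Var 14) (Sto 0 (Var 9) (Cst 1)) (Sto 0 (Var 9) (Cst 0)))))
  (Seq (For 5 (Seq (Rd 14) (setbit 1 5 (Var 14))))
  (Seq (For 5 (If (Arr 1 (Var 5)) (Asg 1 (Var 5)) skip))
  (Seq (Seq (Asg 3 (Cst 1)) (For 5 (Asg 3 (Plus (Var 3) (Var 3)))))
  (Seq (For 5 (setbit 3 5 (Cst 1))) (Seq ctry creset))))).

(** Doubling moves the leading bit of the code to weight [2 ^ n], where comparison with variable 3
    reads it off without division. *)
Definition cdecode := For 5 (Seq (Asg 4 (Plus (Var 4) (Var 4)))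
  (If (Minus (Plus (Var 4) (Cst 1)) (Var 3))
     (Seq (Sto 2 (Var 5) (Cst 1)) (Asg 4 (Minus (Var 4) (Var 3)))) (Sto 2 (Var 5) (Cst 0)))).

Definition cprint := For 5 (If (Arr 2 (Var 5)) (Pr (Var 5)) skip).

Definition cpop := Seq (Asg 4 (Minus (Var 2) (Cst 1))) (Seq (Asg 2 (Minus (Arr 6 (Var 4)) (Cst 1)))
  (Seq cdecode cprint)).

Definition cnbr := Seq (For 11 (For 12 (Seq creroute ctry))) creset.

Lemma wfc_all : [/\ wfc cinit, wfc cpop & wfc cnbr].
Proof. by []. Qed.

(** * Binary codes of vertex sets *)

Fixpoint bigendian (f : nat -> bool) (k j : nat) : nat :=
  if j is j'.+1 then f k * 2 ^ j' + bigendian f k.+1 j' else 0.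

Lemma bigendian_lt f k j : bigendian f k j < 2 ^ j.
Proof.
elim: j k => [|j IH] k //=; have := IH k.+1; rewrite expnS.
by case: (f k); rewrite ?mul0n ?mul1n; lia.
Qed.

Lemma bigendian_rcons f k j : bigendian f k j.+1 = 2 * bigendian f k j + f (k + j).
Proof.
elim: j k => [|j IH] k; first by rewrite /= addn0 muln1 addn0.
by rewrite -[LHS]/(f k * 2 ^ j.+1 + bigendian f k.+1 j.+1) IH /= expnS addSnnS; lia.
Qed.

Lemma bigendian_inj f g k j : bigendian f k j = bigendian g k j ->
  forall i, k <= i < k + j -> f i = g i.
Proof.
elim: j k => [|j IH] k /=; first by move=> _ i; lia.
have hf := bigendian_lt f k.+1 j; have hg := bigendian_lt g k.+1 j.
move=> E; have fg : f k = g k by case: (f k) (g k) E => -[]; lia.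
rewrite fg in E; move/addnI: E => E i; case: (eqVneq i k) => [-> //|ik] hi.
by apply: (IH _ E); lia.
Qed.

(** * Correctness of the routines *)

Section Algorithm.
Variables (n : nat) (e : rel 'I_n) (W : {set 'I_n}) (r : nat).
Implicit Types (X Y Z R : {set 'I_n}) (s : store).

Definition context s : Prop := [/\ var s 0 = n, var s 1 = r,
  forall x y : 'I_n, arr s 0 (x * n + y) = e x y & forall x : 'I_n, arr s 1 x = (x \in W)].

Definition holds s a X : Prop := forall x : 'I_n, arr s a x = (x \in X).

Lemma context_run c s : [/\ 0 \notin wvars c, 1 \notin wvars c, 0 \notin warrs c & 1 \notin warrs c] ->
  context s -> context (run c s).
Proof. by move=> [h1 h2 h3 h4] [c1 c2 c3 c4]; split; rewrite ?run_var ?run_arr. Qed.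

Lemma context_setv s x v : 1 < x -> context s -> context (setv s x v).
Proof. by case: x => [|[|x]] // _ [c1 c2 c3 c4]; split. Qed.

Lemma holds_run c s a X : a \notin warrs c -> holds s a X -> holds (run c s) a X.
Proof. by move=> h hX x; rewrite run_arr. Qed.

(* [y] may read entry [i] of the array being filled, since that entry is still the old one. *)
Lemma fill_spec a i y s (f : nat -> bool) : 1 < i -> context s ->
  (forall s' j, j < n -> var s' i = j -> (forall x, x != i -> var s' x = var s x) ->
     (forall b, b != a -> arr s' b = arr s b) -> arr s' a j = arr s a j -> (0 < ev y s') = f j) ->
  forall j, j < n -> arr (run (For i (setbit a i y)) s) a j = f j.
Proof.
move=> i1 [s0 _ _ _] hy.
pose Inv k s' := [/\ forall x, x != i -> var s' x = var s x,
  forall b, b != a -> arr s' b = arr s b &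
  forall j, arr s' a j = if j < k then nat_of_bool (f j) else arr s a j].
suff [_ _ h] : Inv (var s 0) (run (For i (setbit a i y)) s).
  by move=> j hj; rewrite h s0 hj.
apply: run_for => //; first by lia.
  by split => //= x xi; rewrite /upd (negbTE xi).
rewrite s0 => k s' kn s'i s'0 [h1 h2 h3].
have hk : (0 < ev y s') = f k by apply: hy => //; rewrite h3 ltnn.
have E : run (setbit a i y) s' = seta s' a k (f k).
  by rewrite /= hk s'i; case: (f k).
rewrite E; split.
- by move=> x xi; rewrite /= /upd (negbTE xi) h1.
- by move=> b ba; rewrite /= (negbTE ba) h2.
- move=> j; rewrite /= eqxx /upd h3 ltnS [j <= k]leq_eqVlt.
  by case: (eqVneq j k) => [->|_].
Qed.

Lemma fill_holds a i y s X : 1 < i -> context s ->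
  (forall s' (x : 'I_n), var s' i = x -> (forall x, x != i -> var s' x = var s x) ->
     (forall b, b != a -> arr s' b = arr s b) -> arr s' a x = arr s a x -> (0 < ev y s') = (x \in X)) ->
  holds (run (For i (setbit a i y)) s) a X.
Proof.
move=> i1 cs hy x.
rewrite (@fill_spec a i y s (fun j => if insub j is Some z then z \in X else false)) ?ltn_ord //.
  by rewrite valK.
move=> s' j jn s'j h1 h2 h3; rewrite insubT /=; exact: hy.
Qed.

(** Merges the two nested loops into one over the matrix positions [x * n + y]. *)
Lemma run_matrix (Inv : nat -> store -> Prop) body s : var s 0 = n ->
  all (fun x => x \notin wvars body) [:: 0; 7; 8; 9] ->
  (forall k s x v, x \in [:: 7; 8; 9] -> Inv k s -> Inv k (setv s x v)) -> Inv 0 s ->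
  (forall (x y : 'I_n) s', var s' 0 = n -> var s' 7 = x -> var s' 8 = y -> var s' 9 = x * n + y ->
     Inv (x * n + y) s' -> Inv (x * n + y).+1 (run body s')) ->
  Inv (n * n) (run (cmatrix body) s).
Proof.
move=> s0 /and5P[w0 w7 w8 w9 _] Iv I0 IS.
pose Inv7 k s' := var s' 9 = k * n /\ Inv (k * n) s'.
rewrite /cmatrix run_seq run_asg -[ev _ _]/0.
have nw x : x != 9 -> x != 8 -> x \notin wvars body ->
   x \notin wvars (For 8 (Seq body (Asg 9 (Plus (Var 9) (Cst 1))))).
  by move=> x9 x8 xb; rewrite /= inE mem_cat inE !negb_or x8 x9 xb.
suff : Inv7 (var (setv s 9 0) 0) (run (For 7 (For 8 (Seq body (Asg 9 (Plus (Var 9) (Cst 1)))))) (setv s 9 0)).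
  by rewrite [var (setv s 9 0) 0]s0 => -[].
apply: run_for => //; [exact: nw|exact: nw|by split => //; do 2 apply: (Iv) => //|].
move=> k s1 kn s17 s10 [s19 I1]; rewrite [var (setv s 9 0) 0]s0 in kn s10.
pose Inv8 j s' := [/\ var s' 9 = k * n + j, var s' 7 = k & Inv (k * n + j) s'].
suff : Inv8 (var s1 0) (run (For 8 (Seq body (Asg 9 (Plus (Var 9) (Cst 1))))) s1).
  rewrite s10 => -[h1 h2 h3]; split; first by rewrite [LHS]h1 mulSn addnC.
  by apply: Iv => //; rewrite mulSn addnC.
have nw' x : x != 9 -> x \notin wvars body -> x \notin wvars (Seq body (Asg 9 (Plus (Var 9) (Cst 1)))).
  by move=> x9 xb; rewrite /= mem_cat inE negb_or x9 xb.
apply: run_for => //; [exact: nw'|exact: nw'| |].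
  by split => //=; rewrite addn0 //; apply: Iv.
move=> j s2 jn s28 s20 [s29 s27 I2]; rewrite s10 in jn s20.
have vb x : x \in [:: 0; 7; 8; 9] -> var (run body s2) x = var s2 x.
  by rewrite !inE => /or4P[]/eqP->; apply: run_var.
split.
- rewrite -[LHS]/((var (run body s2) 9) + 1) vb // s29; lia.
- by rewrite -[LHS]/(var (run body s2) 7) vb.
- rewrite addnS run_seq run_asg.
  do 2 apply: (Iv) => //; exact: (IS (Ordinal kn) (Ordinal jn)).
Qed.

Definition root_component X : {set 'I_n} := if insub r is Some x then reach e X x else set0.

Lemma root_component_step X x y : x \in root_component X -> y \in X -> e x y -> y \in root_component X.
Proof.
by rewrite /root_component; case: insubP => [z _ _|_]; [apply: reach_step|rewrite inE].
Qed.

(** Updates happen in place and may spread along several edges in one sweep, so the result is only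
    bracketed between one closure step and the component. *)
Lemma sweep_spec s X R : context s -> holds s 5 X -> holds s 4 R -> R \subset root_component X ->
  exists R', [/\ holds (run csweep s) 4 R', R \subset R', R' \subset root_component X &
    forall x y, x \in R -> y \in X -> e x y -> y \in R'].
Proof.
move=> cs hX hR RC; have [s0 _ _ _] := cs.
pose Inv k s' := [/\ context s', holds s' 5 X & exists R', [/\ holds s' 4 R', R \subset R', R' \subset root_component X &
    forall x y : 'I_n, x * n + y < k -> x \in R -> y \in X -> e x y -> y \in R']].
suff [_ _ [R' [h1 h2 h3 h4]]] : Inv (n * n) (run csweep s).
  exists R'; split => // x y; apply: h4.
  by have := ltn_ord x; have := ltn_ord y; nia.
apply: run_matrix => //.
- by move=> k s1 x v; rewrite !inE => /or3P[]/eqP-> [c1 h1 h2]; split => //; apply: context_setv.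
- by split => //; exists R; split => // x y; rewrite ltn0.
move=> x y s1 s10 s17 s18 s19 [c1 hX1 [R' [h1 h2 h3 h4]]].
have [_ _ hadj _] := c1.
set body := If _ _ _; split; [exact: context_run|exact: holds_run|].
have E : (0 < ev (Minus (Plus (Plus (Arr 4 (Var 7)) (Arr 5 (Var 8))) (Arr 0 (Var 9))) (Cst 2)) s1)
   = [&& x \in R', y \in X & e x y].
  rewrite /= s17 s18 s19 h1 hX1 hadj.
  by case: (x \in R'); case: (y \in X); case: (e x y).
rewrite /body /= E; case: ifP => [/and3P[xR yX xy]|no].
  exists (y |: R'); split.
  - move=> z; rewrite /= /upd s18 !inE.
    by have [->|zy] := eqVneq z y; rewrite ?eqxx //= ifF ?h1 //; apply/negbTE.
  - by apply: subset_trans h2 _; apply: subsetUr.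
  - rewrite subUset h3 andbT sub1set; apply: (root_component_step _ yX xy); exact: (subsetP h3).
  - move=> x' y' lt xR' yX' xy'; rewrite !inE.
    have [->|yy] := eqVneq y' y; first by [].
    apply: (h4 x') => //; rewrite ltn_neqAle -ltnS lt andbT.
    apply/eqP => E'; move/eqP: yy; apply; apply: val_inj => /=.
    have := congr1 (fun k => k %% n) E'; by rewrite !modnMDl !modn_small.
exists R'; split => // x' y' lt xR' yX' xy'.
move: lt; rewrite ltnS leq_eqVlt => /orP[/eqP E'|lt]; last exact: (h4 x' y').
have Ey : y' = y.
  apply: val_inj => /=; have := congr1 (fun k => k %% n) E'; by rewrite !modnMDl !modn_small.
have Ex : x' = x.
  apply: val_inj => /=; have := congr1 (fun k => k %/ n) E'.
  by rewrite !divnMDl ?divn_small ?addn0 //; apply: leq_ltn_trans (ltn_ord x).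
by move: no; rewrite -Ex -Ey xy' yX' (subsetP h2 _ xR').
Qed.

(** [k] sweeps mark the ends of all paths with at most [k] edges, and a path without repetition has
    fewer than [n]. *)
Lemma reach_spec s X : context s -> holds s 5 X -> holds (run creach s) 4 (root_component X).
Proof.
move=> cs hX; rewrite /creach run_seq.
set s1 := run _ s; have c1 : context s1 by apply: context_run.
have hX1 : holds s1 5 X by apply: holds_run.
have [s10 s1r _ _] := c1; have [s0 sr _ _] := cs.
pose R0 : {set 'I_n} := [set x in X | x == r :> nat].
have hR1 : holds s1 4 R0.
  apply: fill_holds => // s2 x s25 sv sa sx; rewrite /= s25 sv // sr sa // hX !inE.
  by case: (x \in X); case: eqP; lia.
pose Inv k s' := [/\ context s', holds s' 5 X & exists R, [/\ holds s' 4 R, R \subset root_component X &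
   forall (x : 'I_n) p, x \in R0 -> path (induced e X) x p -> size p <= k -> last x p \in R]].
have R0C : R0 \subset root_component X.
  apply/subsetP => x; rewrite inE => /andP[xX /eqP xr]; rewrite /root_component -xr valK.
  exact: reach_refl.
suff [_ _ [R [h1 h2 h3]]] : Inv (var s1 0) (run (For 6 csweep) s1).
  suff -> : root_component X = R by [].
  apply/eqP; rewrite eqEsubset h2 andbT; apply/subsetP => y.
  rewrite /root_component; case: insubP => [x _ xr|]; last by rewrite inE.
  rewrite inE => /andP[xX /connectP[p pp ->]].
  case: (shortenP pp) => p' pp' up' _.
  apply: h3 => //; first by rewrite !inE xX /= xr.
  by have := max_card (mem (x :: p')); rewrite (card_uniqP up') card_ord s10 /= => /ltnW.
apply: run_for => //.
  split; [exact: context_setv|by []|]; exists R0; split => // x p xR _.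
  by rewrite leqn0 size_eq0 => /eqP ->.
move=> k s2 kn _ _ [c2 hX2 [R [h1 h2 h3]]].
split; [apply: context_setv => //; exact: context_run|exact: (holds_run _ hX2)|].
have [R' [g1 g2 g3 g4]] := sweep_spec c2 hX2 h1 h2.
exists R'; split => // x p xR; case/lastP: p => [|p y].
  move=> _ _; apply: (subsetP g2); exact: (h3 x [::]).
rewrite rcons_path last_rcons size_rcons ltnS => /andP[pp /and3P[_ yX xy]] sp.
by apply: g4 xy => //; apply: h3.
Qed.

Hypothesis gE : simple_graph e.
Hypothesis rootP : W = set0 \/ exists2 x : 'I_n, x = r :> nat & x \in W.

Lemma connects_comp X : connects e W X = (W \subset root_component X).
Proof.
case: rootP => [->|[x xr xW]].
  by rewrite sub0set; apply/forall_inP => u; rewrite inE.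
by rewrite (connects_reach gE.1 _ xW) /root_component -xr valK.
Qed.

Lemma test_spec s X : context s -> holds s 4 (root_component X) -> var (run ctest s) 10 = connects e W X.
Proof.
move=> cs hC; have [s0 _ _ _] := cs; rewrite /ctest run_seq run_asg -[ev _ _]/1.
pose Inv k s' := [/\ context s', holds s' 4 (root_component X) &
  var s' 10 = [forall x : 'I_n, ((x < k) && (x \in W)) ==> (x \in root_component X)]].
set s1 := setv s 10 1; have s10 : var s1 0 = n by [].
set c := For 5 _.
suff [_ _ ->] : Inv (var s1 0) (run c s1).
  congr nat_of_bool; rewrite connects_comp s10; apply/forallP/subsetP => h x.
    by move=> xW; have := h x; rewrite ltn_ord xW.
  by apply/implyP => /andP[_]; apply: h.
apply: run_for => //.
  split; [by apply: context_setv => //; apply: context_setv|by []|]; rewrite /=.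
  by apply/esym; apply/eqP; rewrite eqb1; apply/forallP => x.
move=> k s2 kn s2k _ [c2 h2 v2]; rewrite s10 in kn.
have [_ _ _ hW] := c2; set x0 := Ordinal kn.
have E : [forall x : 'I_n, ((x < k.+1) && (x \in W)) ==> (x \in root_component X)] =
   [forall x : 'I_n, ((x < k) && (x \in W)) ==> (x \in root_component X)] && ((x0 \in W) ==> (x0 \in root_component X)).
  apply/forallP/andP => [h|[/forallP h1 h2'] x].
    split; last by have := h x0; rewrite /= ltnSn.
    apply/forallP => x; have := h x; case: (ltnP x k) => //= xk.
    by rewrite (leqW xk).
  rewrite ltnS leq_eqVlt; have [xk|xk] := eqVneq (x : nat) k; last exact: h1.
  by have -> : x = x0 by apply: val_inj.
split; [apply: context_setv => //; exact: context_run|by apply: (@holds_run _ s2)|].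
rewrite run_if.
have -> : (0 < ev (Minus (Arr 1 (Var 5)) (Arr 4 (Var 5))) s2) = ~~ ((x0 \in W) ==> (x0 \in root_component X)).
  by rewrite /= s2k -[k]/(x0 : nat) hW h2; case: (x0 \in W); case: (x0 \in root_component X).
rewrite E; case: ((x0 \in W) ==> _); first by rewrite /= andbT -v2.
by rewrite andbF.
Qed.

Lemma del_spec s a u X (v : 'I_n) : a != 5 -> 1 < u -> u != 5 -> context s -> holds s a X ->
  var s u = v -> holds (run (cdel a u) s) 5 (X :\ v).
Proof.
move=> a5 u1 u5 cs hX sv; apply: fill_holds => // s2 x s25 hv ha hx.
rewrite /= s25 hv // ha // hX sv !inE -val_eqE /=.
by case: (x \in X); case: eqP; lia.
Qed.

(** One pass suffices: by monotonicity, a vertex that could not be deleted from a larger set cannot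
    be deleted later. *)
Lemma min_spec s Z : context s -> holds s 3 Z -> connects e W Z ->
  exists2 Z', holds (run cmin s) 3 Z' & minset (connects e W) Z' /\ Z' \subset Z.
Proof.
move=> cs hZ cZ; have [s0 _ _ _] := cs.
pose Inv k s' := context s' /\ exists Z', [/\ holds s' 3 Z', Z' \subset Z, connects e W Z' &
  forall u : 'I_n, u < k -> u \in Z' -> ~~ connects e W (Z' :\ u)].
suff [_ [Z' [h1 h2 h3 h4]]] : Inv (var s 0) (run cmin s).
  exists Z' => //; split => //; apply/minsetP; split => // B cB BZ.
  apply/eqP; rewrite eqEsubset BZ; apply/subsetP => u uZ; apply: contraT => uB.
  have := h4 u; rewrite s0 ltn_ord => /(_ isT uZ)/negP[].
  apply: (connects_monotone gE.1 _ cB); apply/subsetP => x xB.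
  by rewrite !inE (subsetP BZ) // andbT; apply: contraNneq uB => <-.
apply: run_for => //.
  split; first exact: context_setv.
  by exists Z; split => // u; rewrite ltn0.
move=> k s1 kn s1k _ [c1 [Z' [h1 h2 h3 h4]]]; rewrite s0 in kn.
pose v := Ordinal kn; rewrite !run_seq.
set s2 := run (cdel 3 13) s1; have c2 : context s2 by apply: context_run.
have T2 : holds s2 5 (Z' :\ v) by apply: del_spec.
have Z2 : holds s2 3 Z' by apply: holds_run.
have v2 : var s2 13 = k by rewrite run_var.
set s3 := run creach s2; have c3 : context s3 by apply: context_run.
have R3 : holds s3 4 (root_component (Z' :\ v)) by apply: reach_spec.
have Z3 : holds s3 3 Z' by apply: holds_run.
have v3 : var s3 13 = k by rewrite run_var.
set s4 := run ctest s3; have c4 : context s4 by apply: context_run.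
have Z4 : holds s4 3 Z' by apply: holds_run.
have v4 : var s4 13 = k by rewrite run_var.
have t4 : var s4 10 = connects e W (Z' :\ v) by apply: test_spec.
split; first by apply: context_setv => //; apply: context_run.
rewrite run_if -[ev _ _]/(var s4 10) t4 lt0b; case: ifP => cv.
  exists (Z' :\ v); split => //.
  - move=> x; rewrite /= v4 /upd !inE -val_eqE /=; by case: eqP => // _; apply: Z4.
  - by apply: subset_trans h2; apply: subD1set.
  - move=> u uk; rewrite !inE => /andP[uv uZ].
    have uk' : u < k.
      by move: uk; rewrite ltnS leq_eqVlt => /orP[/eqP E|//]; case/eqP: uv; apply: val_inj.
    apply: contra (h4 u uk' uZ); apply: (connects_monotone gE.1); apply: setSD.
    exact: subD1set.
exists Z'; split => // u uk uZ; move: uk; rewrite ltnS leq_eqVlt => /orP[/eqP E|uk]; last exact: h4.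
have -> : u = v by apply: val_inj.
by rewrite cv.
Qed.

Definition bits X (i : nat) : bool := if insub i is Some x then x \in X else false.
Definition code X : nat := bigendian (bits X) 0 n.

Lemma bits_ord X (x : 'I_n) : bits X x = (x \in X).
Proof. by rewrite /bits valK. Qed.

Lemma code_inj : injective code.
Proof.
move=> X Y E; apply/setP => x; rewrite -!bits_ord; apply: (bigendian_inj E).
by rewrite leq0n ltn_ord.
Qed.

Lemma code_lt X : code X < 2 ^ n.
Proof. exact: bigendian_lt. Qed.

Lemma code_spec s Z : context s -> holds s 3 Z -> var (run ccode s) 4 = code Z.
Proof.
move=> cs hZ; have [s0 _ _ _] := cs; rewrite /ccode run_seq run_asg -[ev _ _]/0.
pose Inv k s' := [/\ var s' 0 = n, holds s' 3 Z & var s' 4 = bigendian (bits Z) 0 k].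
set s1 := setv s 4 0; have s10 : var s1 0 = n by [].
set c := For 5 _; suff [_ _] : Inv (var s1 0) (run c s1) by rewrite s10.
apply: run_for => //.
move=> k s2 kn s2k s20 [_ h2 v2]; rewrite s10 in kn s20; split => //.
have hk : arr s2 3 k = bits Z k by have := h2 (Ordinal kn); rewrite -bits_ord.
rewrite bigendian_rcons add0n -[LHS]/(var s2 4 + var s2 4 + arr s2 3 (var s2 5)) s2k v2 hk.
by rewrite mul2n addnn.
Qed.

(** A linked list inside the dictionary. Stack tops are codes plus one, so that 0 means empty;
    entries are the previous top plus one, so that 0 means not found. *)
Fixpoint chain (D : nat -> nat) (t : nat) (st : seq {set 'I_n}) : Prop :=
  if st is X :: st' then [/\ t = (code X).+1, 0 < D (code X) & chain D (D (code X)).-1 st']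
  else t = 0.

Lemma chain_upd D c v t st : c \notin map code st -> chain D t st -> chain (upd D c v) t st.
Proof.
elim: st t => [|X st IH] t //=; rewrite inE negb_or => /andP[cX cst] [h1 h2 h3].
by rewrite {1}/upd eq_sym (negbTE cX) [upd _ _ _ (code X)]/upd eq_sym (negbTE cX); split => //; apply: IH.
Qed.

(* Entry [code X] of the dictionary is positive exactly for the solutions found so
   far and, minus one, is the stack top at the time when [X] was pushed; [st] is the
   stack and [dn] lists the solutions already popped. *)
Definition stack s (st dn : seq {set 'I_n}) : Prop :=
  [/\ uniq (st ++ dn), forall X, X \in st ++ dn -> minset (connects e W) X,
      chain (arr s 6) (var s 2) st,
      forall c, 0 < arr s 6 c <-> exists2 X, X \in st ++ dn & c = code X &
      forall c, arr s 6 c <= (2 ^ n).+1].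

Lemma stack_ext s s' st dn : var s' 2 = var s 2 -> arr s' 6 = arr s 6 ->
  stack s st dn -> stack s' st dn.
Proof. by rewrite /stack => -> ->. Qed.

Lemma stack_run c s st dn : 2 \notin wvars c -> 6 \notin warrs c ->
  stack s st dn -> stack (run c s) st dn.
Proof. by move=> h1 h2; apply: stack_ext; rewrite ?run_var ?run_arr. Qed.

Lemma push_spec s Z st dn : context s -> holds s 3 Z -> minset (connects e W) Z -> stack s st dn ->
  exists2 pre, stack (run cpush s) (pre ++ st) dn & Z \in (pre ++ st) ++ dn.
Proof.
move=> cs hZ mZ sk; rewrite /cpush run_seq; have sk1 := stack_run (c := ccode) isT isT sk.
have c1 := code_spec cs hZ; move: (run ccode s) sk1 c1 => s1 [u1 m1 ch1 d1 b1] c1.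
rewrite run_if -[ev _ _]/(1 - arr s1 6 (var s1 4)) c1 subn_gt0 ltnS leqn0.
case: eqP => [D0|/eqP D0]; last first.
  have Zin : Z \in st ++ dn.
    by rewrite -lt0n in D0; have [X Xin /code_inj ->] := (d1 _).1 D0.
  by exists [::].
have Znew : Z \notin st ++ dn.
  by apply/negP => Zin; have := (d1 (code Z)).2; rewrite D0 => /(_ (ex_intro2 _ _ Z Zin erefl)).
exists [:: Z]; last by rewrite inE eqxx.
have -> : run (Seq (Sto 6 (Var 4) (Plus (Var 2) (Cst 1))) (Asg 2 (Plus (Var 4) (Cst 1)))) s1 =
    setv (seta s1 6 (code Z) (var s1 2).+1) 2 (code Z).+1.
  by rewrite /= c1 !addn1.
split => /=.
- by rewrite Znew.
- by move=> X; rewrite inE => /orP[/eqP->//|]; apply: m1.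
- rewrite /upd !eqxx; split => //; apply: chain_upd ch1.
  apply: contra Znew => /mapP[X Xst /code_inj ->]; by rewrite mem_cat Xst.
- move=> c; rewrite /upd; case: eqP => [->|cZ].
    by split => // _; exists Z => //; rewrite inE eqxx.
  split; first by move/d1 => [X Xin ->]; exists X => //; rewrite inE Xin orbT.
  by move=> [X]; rewrite inE => /orP[/eqP->//|Xin] E; apply/d1; exists X.
- move=> c; rewrite /upd; case: eqP => // _; rewrite ltnS.
  (* The old top is 0 or a code plus one, hence at most [2 ^ n]. *)
  by case: st ch1 {sk u1 m1 d1 Znew} => [-> //|X st [-> _ _]]; apply: code_lt.
Qed.

Lemma try_spec s Z st dn : context s -> holds s 3 Z -> stack s st dn ->
  exists2 pre, stack (run ctry s) (pre ++ st) dn &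
    connects e W Z -> exists2 X', X' \in (pre ++ st) ++ dn & X' \subset Z.
Proof.
move=> cs hZ sk; rewrite /ctry !run_seq.
set s2 := run (For 5 _) s; have c2 : context s2 by apply: context_run.
have T2 : holds s2 5 Z by apply: fill_holds => // s' x s'5 hv ha hx; rewrite /= s'5 ha // hZ lt0b.
have Z2 : holds s2 3 Z by apply: holds_run.
have k2 : stack s2 st dn by apply: stack_run.
set s3 := run creach s2; have c3 : context s3 by apply: context_run.
have R3 : holds s3 4 (root_component Z) by apply: reach_spec.
have Z3 : holds s3 3 Z by apply: holds_run.
have k3 : stack s3 st dn by apply: stack_run.
set s4 := run ctest s3; have c4 : context s4 by apply: context_run.
have Z4 : holds s4 3 Z by apply: holds_run.
have t4 : var s4 10 = connects e W Z by apply: test_spec.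
have k4 : stack s4 st dn by apply: stack_run.
rewrite run_if -[ev _ _]/(var s4 10) t4 lt0b; case: ifP => cZ; last first.
  by exists [::] => //; apply: stack_run.
have [Z' h5 [mZ' Z'Z]] := min_spec c4 Z4 cZ; rewrite run_seq.
have [|pre sk' Zin] := push_spec (s := run cmin s4) _ h5 mZ' (stack_run (c := cmin) isT isT k4).
  exact: context_run.
by exists pre => // _; exists Z'.
Qed.

(** The counterpart of [reroute] for a root given as a number, which need not be a vertex. *)
Definition rerouted X v w : {set 'I_n} := let C := root_component (X :\ v) in
  [set y | [|| y == w, y \in C | [forall x in C, ~~ e x y]]].

Lemma reroute_spec s X (v w : 'I_n) : context s -> holds s 2 X -> var s 11 = v -> var s 12 = w ->
  holds (run creroute s) 3 (rerouted X v w).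
Proof.
move=> cs hX sv sw; rewrite /creroute 4!run_seq.
set s2 := run (cdel 2 11) s; have c2 : context s2 by apply: context_run.
have T2 : holds s2 5 (X :\ v) by apply: del_spec.
have w2 : var s2 12 = w by rewrite run_var.
set s3 := run creach s2; have c3 : context s3 by apply: context_run.
set C := root_component (X :\ v).
have R3 : holds s3 4 C by apply: reach_spec.
have w3 : var s3 12 = w by rewrite run_var.
set s4 := run (For 5 _) s3; have c4 : context s4 by apply: context_run.
have R4 : holds s4 4 C by apply: holds_run.
have w4 : var s4 12 = w by rewrite run_var.
have Z4 : holds s4 3 setT by apply: fill_holds => // *; rewrite inE.
set s5 := run (cmatrix _) s4.
have w5 : var s5 12 = w by rewrite run_var.
pose S k : {set 'I_n} := [set y | (y \in C) || [forall x : 'I_n, ((x * n + y < k) && (x \in C)) ==> ~~ e x y]].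
have c5 : context s5 by apply: context_run.
have Z5 : holds s5 3 [set y | (y \in C) || [forall x in C, ~~ e x y]].
  pose Inv k s' := [/\ context s', holds s' 4 C & holds s' 3 (S k)].
  have [|||||_ _ h] := @run_matrix Inv (If (Minus (Minus (Plus (Arr 4 (Var 7)) (Arr 0 (Var 9))) (Cst 1)) (Arr 4 (Var 8)))
      (Sto 3 (Var 8) (Cst 0)) skip) s4; first by case: c4.
  - by [].
  - by move=> k s' x a; rewrite !inE => /or3P[]/eqP-> [g1 g2 g3]; split => //; apply: context_setv.
  - split => // y; rewrite Z4 !inE; apply/esym/eqP; rewrite eqb1; apply/orP; right.
    by apply/forallP => x; rewrite ltn0.
  - move=> x y s' s'0 s'7 s'8 s'9 [g1 g2 g3].
    have [_ _ hadj _] := g1.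
    split; [exact: context_run|exact: holds_run|].
    have SS z : (z \in S (x * n + y).+1) = (z \in S (x * n + y)) && ~~ [&& z == y, y \notin C, x \in C & e x y].
      rewrite !inE; have [zC|zC] := boolP (z \in C) => /=.
        have [E|//] := eqVneq z y; by rewrite -E zC.
      apply/forallP/andP => [h|[/forallP h1 h2] x'].
        split.
          apply/forallP => x'; have := h x'; case: (ltnP (x' * n + z) (x * n + y)) => //= lt.
          by rewrite (leqW lt).
        apply/negP => /and4P[/eqP E _ xC xy]; have := h x; by rewrite E leqnn xC xy.
      rewrite ltnS leq_eqVlt; have [E|ne] := eqVneq (x' * n + z) (x * n + y); last exact: h1.
      have Ey : z = y.
        apply: val_inj => /=; have := congr1 (fun k => k %% n) E; by rewrite !modnMDl !modn_small.
      have Ex : x' = x.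
        apply: val_inj => /=; have := congr1 (fun k => k %/ n) E.
        by rewrite !divnMDl ?divn_small ?addn0 //; apply: leq_ltn_trans (ltn_ord x).
      rewrite Ex /=; apply/implyP => xC; move: h2; rewrite Ey -Ey zC xC /= Ey eqxx; by [].
    rewrite run_if.
    have -> : (0 < ev (Minus (Minus (Plus (Arr 4 (Var 7)) (Arr 0 (Var 9))) (Cst 1)) (Arr 4 (Var 8))) s')
       = [&& y \notin C, x \in C & e x y].
      by rewrite /= s'7 s'8 s'9 !g2 hadj; case: (x \in C); case: (y \in C); case: (e x y).
    case: ifP => cond z; rewrite SS.
      by rewrite /= /upd s'8 -[z == y]val_eqE cond andbT /=; case: eqP; rewrite ?andbF // andbT => _; apply: g3.
    by rewrite cond andbF andbT; apply: g3.
  move=> y; rewrite h !inE; case: (y \in C) => //=; congr nat_of_bool.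
  apply/forallP/forall_inP => hh x; have := hh x.
    by move=> + xC; rewrite xC andbT => /implyP; apply; have := ltn_ord x; have := ltn_ord y; nia.
  by move=> hx; apply/implyP => /andP[_].
pose Inv k s' := [/\ context s', var s' 12 = w &
  forall y : 'I_n, arr s' 3 y = ((y \in C) || [forall x in C, ~~ e x y] || ((y < k) && (y == w)))].
have [s50 _ _ _] := c5; set c := For 5 _.
suff [_ _ h] : Inv (var s5 0) (run c s5).
  by move=> y; rewrite h inE s50 ltn_ord orbC.
apply: run_for => //.
  split; [exact: context_setv|by []|]; move=> y; by rewrite /= Z5 !inE orbF.
move=> k s6 kn s6k _ [g1 g2 g3]; rewrite s50 in kn.
split; [by apply: context_setv => //; apply: context_run|by rewrite -g2 -[RHS](run_var (c := If (same (Var 5) (Var 12)) (Sto 3 (Var 5) (Cst 1)) skip)) |].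
rewrite run_if.
have -> : (0 < ev (same (Var 5) (Var 12)) s6) = (k == w) by rewrite /= s6k g2; case: eqP; lia.
move=> y; case: eqP => kw; rewrite /= /upd.
  rewrite s6k -val_eqE /=; case: eqP => [->|yk].
    by rewrite ltnSn kw eqxx orbT.
  rewrite g3 -val_eqE /= ; congr (nat_of_bool (_ || _)).
  by case: eqP => [E|]; rewrite ?andbF //; case: yk; rewrite E.
rewrite g3 -val_eqE /=; congr (nat_of_bool (_ || _)).
by case: eqP => [E|]; rewrite ?andbF // !andbT; move: kw; rewrite -E; case: ltngtP; lia.
Qed.

Lemma encode_set_bits X : encode_set X = [seq i <- iota 0 n | bits X i].
Proof.
rewrite /encode_set -val_enum_ord filter_map; congr map.
by rewrite enumT /enum_mem; apply: eq_filter => x; rewrite /= bits_ord.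
Qed.

Lemma decode_spec s X : var s 0 = n -> var s 3 = 2 ^ n -> var s 4 = code X ->
  holds (run cdecode s) 2 X.
Proof.
move=> s0 s3 s4.
(* Bits [k] to [n - 1] are still to be read and stand shifted to the left by [k]. *)
pose Inv k s' := [/\ var s' 3 = 2 ^ n, var s' 4 = bigendian (bits X) k (n - k) * 2 ^ k &
  forall j, j < k -> arr s' 2 j = bits X j].
suff [_ _ h] : Inv (var s 0) (run cdecode s).
  by move=> x; rewrite h ?s0 ?ltn_ord // bits_ord.
apply: run_for => //.
  by split => //; rewrite -[LHS]/(var s 4) s4 subn0 muln1.
move=> k s' kn s'k s'0 [h3 h4 h2]; rewrite s0 in kn s'0.
have E : n - k = (n - k.+1).+1 by lia.
rewrite E -[bigendian _ _ _]/(bits X k * 2 ^ (n - k.+1) + bigendian (bits X) k.+1 (n - k.+1)) in h4.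
set f := bigendian _ _ _ in h4.
have nE : 2 ^ n = 2 ^ (n - k.+1) * 2 ^ k.+1 by rewrite -expnD subnK.
have fl : f * 2 ^ k.+1 < 2 ^ n by rewrite nE ltn_pmul2r ?expn_gt0 //; apply: bigendian_lt.
have dbl : var s' 4 + var s' 4 = bits X k * 2 ^ n + f * 2 ^ k.+1.
  by rewrite nE h4 expnS; lia.
rewrite run_seq run_asg -[ev _ _]/(var s' 4 + var s' 4) dbl run_if.
set v := _ + _; set s5 := setv s' 4 v.
have cond : (0 < ev (Minus (Plus (Var 4) (Cst 1)) (Var 3)) s5) = bits X k.
  by rewrite -[ev _ _]/(v + 1 - var s' 3) h3 /v; case: (bits X k); lia.
rewrite cond; have [bk|bk] := boolP (bits X k); split => //.
- by rewrite -[LHS]/(v - var s' 3) h3 /v bk mul1n addKn.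
- move=> j; rewrite ltnS leq_eqVlt /= /upd s'k => /orP[/eqP ->|jk]; first by rewrite eqxx bk.
  by rewrite ltn_eqF // h2.
- by rewrite -[LHS]/v /v (negbTE bk).
- move=> j; rewrite ltnS leq_eqVlt /= /upd s'k => /orP[/eqP ->|jk]; first by rewrite eqxx (negbTE bk).
  by rewrite ltn_eqF // h2.
Qed.

Lemma print_spec s X : var s 0 = n -> holds s 2 X ->
  printed (run cprint s) = printed s ++ encode_set X.
Proof.
move=> s0 hX; rewrite encode_set_bits.
pose Inv k s' := holds s' 2 X /\ printed s' = printed s ++ [seq i <- iota 0 k | bits X i].
suff [_] : Inv (var s 0) (run cprint s) by rewrite s0.
apply: run_for => //; first by split => //; rewrite cats0.
move=> k s' kn s'k _ [h1 h2]; rewrite s0 in kn; split; first exact: (@holds_run _ s').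
have hk : arr s' 2 k = bits X k by have := h1 (Ordinal kn); rewrite -bits_ord.
have -> : iota 0 k.+1 = rcons (iota 0 k) k by rewrite -addn1 iotaD cats1.
rewrite filter_rcons run_if -[ev _ _]/(arr s' 2 (var s' 5)) s'k hk lt0b.
by case: (bits X k); rewrite /= h2 // s'k rcons_cat.
Qed.

(** Popping leaves the dictionary alone, so [X] stays recorded as found. *)
Lemma pop_spec s X st dn : context s -> var s 3 = 2 ^ n -> stack s (X :: st) dn ->
  [/\ holds (run cpop s) 2 X, stack (run cpop s) st (rcons dn X),
     printed (run cpop s) = printed s ++ encode_set X & rest (run cpop s) = rest s].
Proof.
move=> cs s3 [u1 m1 [t1 d1 ch1] dd b1]; have [s0 _ _ _] := cs.
have mm Y : (Y \in st ++ rcons dn X) = (Y \in (X :: st) ++ dn).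
  rewrite cat_cons inE !mem_cat mem_rcons inE.
  by case: (Y == X); case: (Y \in st); case: (Y \in dn).
split; last by rewrite run_rest.
all: rewrite /cpop 3!run_seq 2!run_asg; set s2 := setv _ 2 _.
all: have s24 : var s2 4 = code X by [rewrite /s2 /= t1 subn1].
all: have s20 : var s2 0 = n by [].
- by apply: holds_run => //; apply: decode_spec.
- apply: stack_run => //; apply: stack_run => //.
  have v2 : var s2 2 = (arr s 6 (code X)).-1 by rewrite /s2 /= /upd /= t1 subn1 subn1.
  split => //.
  - by rewrite -cats1 catA cats1 rcons_uniq -cons_uniq.
  - by move=> Y; rewrite mm; apply: m1.
  - by rewrite v2.
  - by move=> c; rewrite dd; split => -[Y Yin ->]; exists Y => //; rewrite ?mm // -mm.
- rewrite (@print_spec _ X) ?run_var //; last exact: decode_spec.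
  by rewrite run_printed.
Qed.

Lemma nbr_spec s X st dn : context s -> holds s 2 X -> stack s st dn ->
  exists2 pre, stack (run cnbr s) (pre ++ st) dn &
    forall v w, connects e W (rerouted X v w) ->
    exists2 X', X' \in (pre ++ st) ++ dn & X' \subset rerouted X v w.
Proof.
move=> cs hX sk; have [s0 _ _ _] := cs; rewrite /cnbr run_seq.
(* [P] marks the pairs tried so far, in lexicographic order. *)
pose Inv (P : 'I_n -> 'I_n -> bool) s' := [/\ context s', holds s' 2 X &
  exists2 pre, stack s' (pre ++ st) dn & forall v w, P v w -> connects e W (rerouted X v w) ->
    exists2 X', X' \in (pre ++ st) ++ dn & X' \subset rerouted X v w].
have Isetv P x a s' : 2 < x -> Inv P s' -> Inv P (setv s' x a).
  move=> x2 [h1 h2 [pre h3 h4]]; split => //; first by apply: context_setv => //; lia.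
  by exists pre => //; apply: stack_ext h3 => //=; rewrite /upd ifF //; apply/eqP; lia.
have Iext P Q s' : (forall v w, P v w = Q v w) -> Inv P s' -> Inv Q s'.
  by move=> PQ [h1 h2 [pre h3 h4]]; split => //; exists pre => // v w; rewrite -PQ; apply: h4.
suff [_ _ [pre h1 h2]] : Inv (fun v w => (v < var s 0) : bool) (run (For 11 (For 12 (Seq creroute ctry))) s).
  exists pre; first by apply: stack_run.
  by move=> v w; apply: h2; rewrite s0 ltn_ord.
apply: (@run_for (fun k => Inv (fun v w => (v < k) : bool))) => //.
  by apply: (Isetv) => //; split => //; exists [::].
move=> k s1 kn s1k s10 I1; rewrite s0 in kn s10; apply: (Isetv) => //.
suff : Inv (fun v w => (v < k) || (v == k :> nat) && (w < var s1 0)) (run (For 12 (Seq creroute ctry)) s1).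
  by apply: (Iext) => v w; rewrite s10 ltn_ord andbT ltnS orbC -leq_eqVlt.
pose Inv2 j s' := var s' 11 = k /\ Inv (fun v w => (v < k) || (v == k :> nat) && (w < j)) s'.
suff [] : Inv2 (var s1 0) (run (For 12 (Seq creroute ctry)) s1) by [].
apply: run_for => //.
  by split => //; apply: (Isetv) => //; apply: (Iext _ _ _ _ I1) => v w; rewrite ltn0 andbF orbF.
move=> j s2 jn s2j s20 [s2k I2]; rewrite s10 in jn s20.
split; first by rewrite -[LHS]/(var (run (Seq creroute ctry) s2) 11) run_var.
apply: (Isetv) => //; case: I2 => [c2 X2 [pre k2 done2]]; rewrite run_seq.
set s3 := run creroute s2; have c3 : context s3 by apply: context_run.
have Z3 : holds s3 3 (rerouted X (Ordinal kn) (Ordinal jn)) by apply: reroute_spec.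
have k3 : stack s3 (pre ++ st) dn by apply: stack_run.
have [pre' k4 h4] := try_spec c3 Z3 k3.
have X3 : holds s3 2 X by apply: holds_run.
split; [exact: context_run|exact: holds_run|].
exists (pre' ++ pre); first by rewrite -catA.
move=> v w hvw cvw.
have [/andP[/eqP vk /eqP wj]|ne] := boolP ((v == k :> nat) && (w == j :> nat)).
  have vE : v = Ordinal kn by apply: val_inj.
  have wE : w = Ordinal jn by apply: val_inj.
  rewrite vE wE in cvw *; have [X' X'in X's] := h4 cvw.
  by exists X' => //; move: X'in; rewrite -!catA.
have [|X' X'in X's] := done2 v w _ cvw.
  by move: hvw ne; case: ltngtP => //= _; rewrite ltnS leq_eqVlt; case: eqP.
by exists X' => //; rewrite -!catA mem_cat; apply/orP; right; rewrite catA.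
Qed.

End Algorithm.

(** * Initialisation *)

Lemma reset_spec s : (forall x, 16 <= x -> var s x = 0) -> forall x, 3 < x -> var (run creset s) x = 0.
Proof.
move=> h x x3; have [x16|x16] := ltnP x 16; last first.
  by rewrite run_var ?h //=; rewrite !inE; lia.
by move: x3 x16; do 16 (case: x => [|x] //).
Qed.

Lemma wvars_lt c x : all (ltn^~ 16) (wvars c) -> 16 <= x -> x \notin wvars c.
Proof. by move=> /allP h x16; apply/negP => /h /=; rewrite ltnNge x16. Qed.

Lemma nth_allpairs_nat (S T : Type) (f : S -> T -> nat) x0 y0 (s : seq S) (t : seq T) i j :
  i < size s -> j < size t ->
  nth 0 [seq f x y | x <- s, y <- t] (i * size t + j) = f (nth x0 s i) (nth y0 t j).
Proof.
elim: s i => [|a s IH] [|i] //= hi hj.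
  by rewrite nth_cat size_map hj (nth_map y0).
by rewrite nth_cat size_map mulSn -addnA ltnNge leq_addr /= addKn IH.
Qed.

Section Init.
Variables (n : nat) (e : rel 'I_n) (W : {set 'I_n}).
Hypothesis gE : simple_graph e.

Definition adjacency_words : seq nat := [seq nat_of_bool (e x y) | x <- enum 'I_n, y <- enum 'I_n].
Definition terminal_words : seq nat := [seq nat_of_bool (x \in W) | x <- enum 'I_n].

Lemma size_adjacency_words : size adjacency_words = n * n.
Proof. by rewrite size_allpairs size_enum_ord. Qed.

Lemma nth_adjacency_words (x y : 'I_n) : nth 0 adjacency_words (x * n + y) = e x y.
Proof.
have := @nth_allpairs_nat _ _ (fun x y => nat_of_bool (e x y)) x y (enum 'I_n) (enum 'I_n) x y.
by rewrite size_enum_ord !nth_ord_enum => ->.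
Qed.

Lemma nth_terminal_words (x : 'I_n) : nth 0 terminal_words x = (x \in W).
Proof. by rewrite (nth_map x) ?size_enum_ord // nth_ord_enum. Qed.

Definition is_root (r : nat) : Prop := r <= n /\ (W = set0 \/ exists2 x : 'I_n, x = r :> nat & x \in W).

Definition bit_arrays (s : store) : Prop :=
  forall a, a < 8 -> a != 6 -> bit_array (n + n * n) (arr s a).

Lemma bit_arrays_run c s : wfc c -> var s 0 = n ->
  all (fun a => bitsafe a [::] c) [:: 0; 1; 2; 3; 4; 5; 7] ->
  bit_arrays s -> bit_arrays (run c s).
Proof.
move=> wc s0 /allP hc hs a a8 a6; apply: (bitsafe_run (G := [::])) => //.
- by apply: hc; move: a8 a6; do 8 (case: a => [|a] //).
- by rewrite s0 leq_addr.
- exact: hs.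
Qed.

Lemma behead_drop (T : Type) k (l : seq T) : behead (drop k l) = drop k.+1 l.
Proof. by rewrite -drop1 drop_drop add1n. Qed.

Lemma head_drop (k : nat) (l : seq nat) : head 0 (drop k l) = nth 0 l k.
Proof. by rewrite -nth0 nth_drop addn0. Qed.

Let s0 := Store (upd (fun=> 0) 0 n) (fun _ _ => 0) (adjacency_words ++ terminal_words) [::].

Lemma init_spec : let s := run cinit s0 in
  exists r st, [/\ is_root r, context e W r s, stack e W s st [::] &
    (exists Y, connects e W Y) -> st != [::]] /\
  [/\ var s 3 = 2 ^ n, forall x, 3 < x -> var s x = 0, rest s = [::], printed s = [::] & bit_arrays s].
Proof.
rewrite /cinit 6!run_seq.
set s1 := run (cmatrix _) s0; set s2 := run _ s1; set s3 := run _ s2.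
rewrite (run_seq (Asg 3 _)); set s4 := run _ (run (Asg 3 _) s3); set s5 := run _ s4.
have s10 : var s1 0 = n by rewrite run_var.
have [r1 a1] : rest s1 = terminal_words /\
    forall i, arr s1 0 i = if i < n * n then nth 0 adjacency_words i else 0.
  pose Inv k s' := rest s' = drop k adjacency_words ++ terminal_words /\
    forall i, arr s' 0 i = if i < k then nth 0 adjacency_words i else 0.
  suff [h1 h2] : Inv (n * n) s1.
    by split; [rewrite h1 drop_oversize // size_adjacency_words|].
  apply: run_matrix => //.
  - by rewrite /Inv drop0; split.
  move=> x y s _ _ _ s9 [h1 h2].
  have lt : x * n + y < size adjacency_words.
    by rewrite size_adjacency_words; have := ltn_ord x; have := ltn_ord y; nia.
  rewrite run_seq; set s' := run (Rd 14) s.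
  have v14 : var s' 14 = e x y.
    rewrite -[LHS]/(head 0 (rest s)) h1 -[RHS]/(nat_of_bool _) -(nth_adjacency_words x y).
    by rewrite (drop_nth 0 lt).
  have rs' : rest s' = drop (x * n + y).+1 adjacency_words ++ terminal_words.
    by rewrite -[LHS]/(behead (rest s)) h1 (drop_nth 0 lt).
  have -> : run (If (Var 14) (Sto 0 (Var 9) (Cst 1)) (Sto 0 (Var 9) (Cst 0))) s' = seta s' 0 (x * n + y) (e x y).
    by rewrite run_if -[ev _ _]/(var s' 14) v14; case: (e x y); rewrite -s9.
  split => // i; rewrite /= /upd ltnS [i <= _]leq_eqVlt.
  by case: (eqVneq i (x * n + y)) => [->|_]; [rewrite nth_adjacency_words|rewrite h2].
have [r2 W2] : rest s2 = [::] /\ holds s2 1 W.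
  pose Inv k s' := rest s' = drop k terminal_words /\ forall x : 'I_n, x < k -> arr s' 1 x = (x \in W).
  have [h1 h2] : Inv (var s1 0) s2.
    apply: run_for => //; first by split; rewrite ?drop0.
    move=> k s kn sk _ [h1 h2]; rewrite s10 in kn; rewrite run_seq; set s' := run (Rd 14) s.
    have v14 : var s' 14 = (Ordinal kn \in W).
      by rewrite -[LHS]/(head 0 (rest s)) h1 head_drop -nth_terminal_words.
    have -> : run (setbit 1 5 (Var 14)) s' = seta s' 1 k (Ordinal kn \in W).
      by rewrite run_if -[ev _ _]/(var s' 14) v14; case: (_ \in W); rewrite -sk.
    split; first by rewrite -[LHS]/(behead (rest s)) h1 behead_drop.
    move=> x; rewrite ltnS leq_eqVlt /= /upd; case: eqP => [xk _|_]; last exact: h2.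
    by congr (nat_of_bool (_ \in W)); apply: val_inj.
  split; first by rewrite h1 drop_oversize // size_map size_enum_ord s10.
  by move=> x; apply: h2; rewrite s10.
have s20 : var s2 0 = n by rewrite run_var.
have W3 : holds s3 1 W by apply: holds_run.
have root3 : is_root (var s3 1).
  (* The weak inequality admits the initial value 0 when there are no vertices. *)
  pose Inv k s' := [/\ holds s' 1 W, var s' 1 <= n &
     (forall x : 'I_n, x < k -> x \notin W) \/ exists2 x : 'I_n, x = var s' 1 :> nat & x \in W].
  have [h1 h2 h3] : Inv (var s2 0) s3.
    apply: run_for => //.
      split => //; last by left.
      by rewrite -[var _ 1]/(var s2 1) !run_var.
    move=> k s kn sk _ [h1 h2 h3]; rewrite s20 in kn.
    rewrite run_if -[ev _ _]/(arr s 1 (var s 5)) sk (h1 (Ordinal kn)) lt0b.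
    case: ifP => kW; split => //=.
    - by rewrite /upd /= sk ltnW.
    - by right; exists (Ordinal kn).
    - case: h3 => [h3|h3]; [left|by right] => x; rewrite ltnS leq_eqVlt => /orP[/eqP xk|]; last exact: h3.
      by have -> : x = Ordinal kn; [apply: val_inj|rewrite kW].
  split => //; case: h3 => [h3|]; [left|by right].
  by apply/setP => x; rewrite inE; apply/negbTE/h3; rewrite s20.
set r := var s3 1 in root3; exists r.
have c3 : context e W r s3.
  split => //; first by rewrite run_var.
  move=> x y; rewrite run_arr // run_arr // a1 nth_adjacency_words ifT //.
  by have := ltn_ord x; have := ltn_ord y; nia.
have s30 : var s3 0 = n by case: c3.
have c4 : context e W r s4 by apply: context_run => //; apply: context_run.
have v4 : var s4 3 = 2 ^ n.
  pose Inv k s' := var s' 3 = 2 ^ k.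
  have : Inv (var (run (Asg 3 (Cst 1)) s3) 0) s4.
    apply: run_for => // k s _ _ _; rewrite /Inv /= /upd /= => ->.
    by rewrite expnS mul2n addnn.
  by rewrite /Inv -[var _ 0]/(var s3 0) s30.
have c5 : context e W r s5 by apply: context_run.
have Z5 : holds s5 3 [set: 'I_n] by apply: (fill_holds _ c4) => // *; rewrite inE.
have sk5 : stack e W s5 [::] [::].
  have E1 : arr s5 6 = fun=> 0 by do 6 rewrite run_arr //.
  have E2 : var s5 2 = 0 by do 6 rewrite run_var //.
  by rewrite /stack E1 E2; split => // c; split => // -[].
have [pre sk6 h6] := try_spec gE root3.2 c5 Z5 sk5.
have c6 : context e W r (run ctry s5) by apply: context_run.
have zs : forall x, 16 <= x -> var (run ctry s5) x = 0.
  move=> x x16; do 7 (rewrite run_var; last by apply: wvars_lt).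
  by rewrite /s0 /= /upd ifF //; apply/eqP; lia.
have rest5 : rest (run ctry s5) = [::] by do 5 rewrite run_rest //.
exists pre; split; split => //.
- by apply: stack_run => //; move: sk6; rewrite cats0.
- move=> [Y cY]; have [|X'] := h6; first exact: (connects_monotone gE.1 (subsetT Y) cY).
  by rewrite !cats0; case: (pre).
- by rewrite run_var // run_var // run_var.
- exact: reset_spec.
- by do 8 rewrite run_printed //.
(* The matrix is written at variable 9, which is no loop counter, so its bound comes from its known
   contents. *)
move=> a a8 a6; have [->|a0] := eqVneq a 0.
  rewrite (_ : arr _ 0 = arr s1 0); last by do 7 rewrite run_arr //.
  move=> i; rewrite a1; case: ifP => // hi; split; last by lia.
  have n0 : 0 < n by case: (n) hi => //; rewrite muln0.
  have hx : i %/ n < n by rewrite ltn_divLR.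
  have hy : i %% n < n by rewrite ltn_mod.
  by rewrite (divn_eq i n) (nth_adjacency_words (Ordinal hx) (Ordinal hy)); case: (e _ _).
have -> : run creset (run ctry s5) = run cinit s0 by rewrite /cinit 6!run_seq (run_seq (Asg 3 _)).
apply: (bitsafe_run (G := [::])) => //.
- by move: a8 a6 a0; do 8 (case: a => [|a] //).
- exact: leq_addr.
Qed.

End Init.

(** * The invariant of the traversal *)

Section Enumeration.
Variables (n : nat) (e : rel 'I_n) (W : {set 'I_n}).
Hypotheses (gE : simple_graph e) (cfE : claw_free e).

(** Closure under rerouting is demanded only for the popped solutions [dn]; once the stack is empty
    it is the hypothesis of [reroute_closed_complete]. *)
Definition invariant (os : seq (seq nat)) (s : store) : Prop := exists r st dn,
  [/\ is_root W r, context e W r s, stack e W s st dn, os = [seq encode_set X | X <- dn] &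
      (exists Y, connects e W Y) -> st ++ dn != [::]] /\
  [/\ var s 3 = 2 ^ n, forall x, 3 < x -> var s x = 0, rest s = [::], printed s = [::] & bit_arrays n s] /\
  forall X v w, X \in dn -> connects e W (rerouted e r X v w) ->
    exists2 X', X' \in st ++ dn & X' \subset rerouted e r X v w.

Lemma invariant_init : invariant [::]
  (run cinit (Store (upd (fun=> 0) 0 n) (fun _ _ => 0) (adjacency_words e ++ terminal_words W) [::])).
Proof.
have [r [st [[h1 h2 h3 h4] h5]]] := init_spec W gE.
by exists r, st, [::]; split; [split => //; rewrite cats0|split].
Qed.

Lemma invariant_next os s : invariant os s -> 0 < var s 2 ->
  let s1 := run cpop s in rest s1 = [::] /\ invariant (rcons os (printed s1)) (run cnbr (flush s1)).
Proof.
move=> [r [st [dn [[root cs sk ho _] [[v3 vz re pr ba] cl]]]]] top s1.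
have [X [st' E]] : exists X st', st = X :: st'.
  case: st sk {cl} => [[_ _ t0 _ _]|X st _]; last by exists X, st.
  by move: top; rewrite (t0 : var s 2 = 0).
rewrite {}E {st} in sk cl; move: st' sk cl => st sk cl.
have [X1 sk1 pr1 re1] := pop_spec cs v3 sk; rewrite -/s1 in X1 sk1 pr1 re1.
rewrite re in re1; split => //.
have c1 : context e W r (flush s1) by have [] : context e W r s1 by apply: context_run.
have [pre sk2 h2] := nbr_spec gE root.2 c1 X1 sk1.
have [s0 _ _ _] := cs; have s10 : var (flush s1) 0 = n by case: c1.
exists r, (pre ++ st), (rcons dn X); split; [split => //|split; [split|]].
- exact: context_run.
- by rewrite map_rcons -ho pr1 pr.
- by rewrite -size_eq0 size_cat size_rcons addnS.
- by rewrite run_var // -[var (flush s1) 3]/(var s1 3) run_var.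
- rewrite /cnbr run_seq; apply: reset_spec => x x16.
  rewrite run_var; last by apply: wvars_lt.
  rewrite -[var (flush s1) x]/(var s1 x) run_var; last by apply: wvars_lt.
  by apply: vz; lia.
- by rewrite run_rest.
- by rewrite run_printed.
- by apply: bit_arrays_run => //; apply: (@bit_arrays_run n cpop s).
move=> Y v w; rewrite mem_rcons inE => /orP[/eqP->|Ydn]; first exact: h2.
move=> /(cl _ _ _ Ydn)[X' X'in X's]; exists X' => //.
move: X'in; rewrite cat_cons inE !mem_cat mem_rcons inE.
by case: (X' == X); case: (X' \in st); case: (X' \in dn); rewrite ?orbT.
Qed.

Lemma invariant_size os s : invariant os s -> size os <= #|{set 'I_n}|.
Proof.
move=> [r [st [dn [[_ _ [u _ _ _ _] -> _] _]]]]; rewrite size_map.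
have ud : uniq dn by move: u; rewrite cat_uniq => /and3P[].
by rewrite -(card_uniqP ud) max_card.
Qed.

Lemma invariant_done os s : invariant os s -> var s 2 = 0 ->
  perm_eq os [seq encode_set X | X <- enum (min_steiner e W)].
Proof.
move=> [r [st [dn [[root cs sk -> ne] [_ cl]]]]] top.
case: st sk ne cl => [|X st] [u m ch _ _] ne cl; last by case: ch; rewrite top.
rewrite cat0s in u m ne cl; apply/perm_map/uniq_perm => //; first exact: enum_uniq.
move=> Y; rewrite mem_enum inE; apply/idP/idP => [/m //|mY].
have {}ne : dn != [::] by apply: ne; exists Y; apply: minsetp mY.
(* Without terminals the search has no start, but then the empty set is the only minimal
   solution. *)
case: root => _ [W0|[x xr xW]].
  have c0 : connects e W set0 by apply/forall_inP => u'; rewrite W0 inE.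
  have E0 Z : minset (connects e W) Z -> Z = set0.
    by move=> mZ; rewrite (minsetinf mZ c0) // sub0set.
  by case: dn ne m {cl u} => // X dn _ m; rewrite (E0 _ mY) -(E0 X) ?mem_head // m ?mem_head.
have rE X v w : rerouted e r X v w = reroute e x X v w.
  have cE : root_component e r (X :\ v) = reach e (X :\ v) x by rewrite /root_component -xr valK.
  by rewrite /rerouted /reroute cE.
suff : Y \in [set X in dn] by rewrite inE.
apply: (reroute_closed_complete gE cfE xW) => //.
- by move=> X; rewrite inE; apply: m.
- move=> X v w; rewrite inE -rE => Xdn /(cl _ _ _ Xdn)[X' X'in X's].
  by exists X' => //; rewrite inE.
- by case: dn ne {m cl u} => // X dn _; apply/set0Pn; exists X; rewrite !inE eqxx.
Qed.

(** Dictionary addresses are of order [8 * 2 ^ n], matrix addresses of order [8 * n ^ 2]; both fit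
    below [2 ^ (2 * n + 8)]. *)
Lemma invariant_safe b os s : 2 * n + 8 <= b -> invariant os s ->
  [/\ var s 0 = n, rest s = [::], printed s = [::] & store_bounded b s].
Proof.
move=> hb [r [st [dn [[[rn _] [s0 s1 _ _] [_ _ ch dd b6] _ _] [[v3 vz re pr ba] _]]]]].
split => //.
have nN : n < 2 ^ n by apply: ltn_expl.
have bN : 256 * (2 ^ n * 2 ^ n) <= 2 ^ b.
  by apply: leq_trans (_ : 2 ^ (2 * n + 8) <= _); [rewrite expnD mul2n -addnn expnD mulnC|rewrite leq_exp2l].
have top : var s 2 <= 2 ^ n.
  by case: st ch {dd} => [-> //|X st [-> _ _]]; apply: code_lt.
have d6 c : 0 < arr s 6 c -> c < 2 ^ n by move/dd => [X _ ->]; apply: code_lt.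
rewrite /store_bounded; move: (2 ^ n) (2 ^ b) nN bN v3 b6 d6 top => N M nN bN v3 b6 d6 top.
have NM : 100 + 8 * N <= M by nia.
split=> [x x32|a i a8].
  by case: x x32 => [|[|[|[|x]]]] _; [rewrite s0|rewrite s1| |rewrite v3|rewrite vz //]; lia.
have [->|a6] := eqVneq a 6.
  by split; [have := b6 i; lia|rewrite -lt0n => /d6; lia].
have [h1 h2] := ba a a8 a6 i; split; first by lia.
by move=> /h2; nia.
Qed.

End Enumeration.

(** * Polynomial bounds in the input size *)

Fixpoint prog_bound (P : program) : nat := if P is i :: P' then maxn (ibound i) (prog_bound P') else 0.

Lemma leq_prog_bound P i j : onth P j = Some i -> ibound i <= prog_bound P.
Proof.
elim: P j => [|k P IH] [|j] //=; first by case=> ->; apply: leq_maxl.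
by move/IH => h; apply: leq_trans h (leq_maxr _ _).
Qed.

Lemma size_leq_input (s : seq nat) : size s <= input_size s.
Proof. by rewrite /input_size -sum1_size; apply: leq_sum. Qed.

Lemma delay_mono P s L D D' : D <= D' -> enumerates_with_delay P s L D -> enumerates_with_delay P s L D'.
Proof.
move=> DD [c [h1 h2 h3 h4]]; exists c; split => //; apply: sub_path h4 => t1 t2 /= h.
by apply: leq_trans h _; rewrite leq_add2l.
Qed.

Lemma space_mono P s S S' : S <= S' -> runs_in_space P s S -> runs_in_space P s S'.
Proof. by move=> SS h c /h[A h1 h2]; exists A => //; apply: leq_trans SS. Qed.

Theorem theorem7p4 :
  exists (P : program) (p q : {poly nat}),
  forall (n : nat) (e : rel 'I_n) (W : {set 'I_n}),
  simple_graph e -> claw_free e ->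
  let s := encode_input e W in
  enumerates_with_delay P s [seq encode_set X | X <- enum (min_steiner e W)]
    (p.[input_size s])%R
  /\ runs_in_space P s (2 ^ (q.[input_size s])%R).
Proof.
pose P := driver cinit cpop cnbr 2.
have [m hm] : exists m, forall i j, onth P j = Some i -> ibound i <= m.
  by exists (prog_bound P) => i j; apply: leq_prog_bound.
pose tp := (steps_poly cinit + steps_poly cpop + steps_poly cnbr + 38%N%:P)%R.
pose bp := (2%N%:P * 'X + (8 + m)%N%:P + tp)%R.
(* At [n], [tp] is the instruction count [T] of a segment and [bp] the bit bound [B]; the witnesses
   are [2 * Delta] and the exponent [2 * B + 2]. *)
exists P, (2%N%:P * (tp * (2%N%:P * (bp + 1%N%:P))))%R, (2%N%:P * bp + 2%N%:P)%R.
move=> n e W gE cfE s.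
have tpE : (tp.[n])%R = dsteps cinit cpop cnbr n.
  by rewrite /tp 3!hornerD !horner_steps_poly hornerC.
(* [2 * n + 8] serves the store invariant, [m] the constants and register numbers in the program. *)
pose b := 2 * n + (8 + m).
have bpE : (bp.[n])%R = b + dsteps cinit cpop cnbr n.
  by rewrite hornerD tpE hornerD hornerM !hornerC hornerX.
clearbody bp tp.
have hb : 2 * n + 8 <= b by rewrite /b; lia.
have hn : n <= input_size s.
  apply: leq_trans (size_leq_input s).
  by rewrite /= size_cat size_map size_enum_ord; lia.
have pb x : x <= b -> x <= 2 ^ b by move=> h; apply: leq_trans h (ltnW (ltn_expl _ _)).
have hP i j : onth P j = Some i -> ibound i <= 2 ^ b.
  by move/hm => h; apply/pb/(leq_trans h)/(leq_trans (leq_addl 8 m))/leq_addl.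
have hinp : all (leq^~ (2 ^ b)) s.
  have b01 (x : bool) : x <= 2 ^ b by apply: pb; rewrite /b; case: x; lia.
  apply/allP => x; rewrite inE mem_cat => /or3P[/eqP ->|/allpairsP[[y z] [_ _ ->]]|/mapP[y _ ->]] //.
  by apply: pb; rewrite /b; lia.
have b6 : 6 <= b by rewrite /b; lia.
have [wi wp wn] := wfc_all.
have [h1 h2] := @driver_correct cinit cpop cnbr 2 wi wp wn isT (invariant e W) n b
  #|{set 'I_n}| (adjacency_words e ++ terminal_words W)
  [seq encode_set X | X <- enum (min_steiner e W)] b6 hP hinp (invariant_init W gE)
  (fun os s => invariant_safe hb) (invariant_next gE) (@invariant_size n e W) (invariant_done gE cfE).
split; [apply: delay_mono h1|apply: space_mono h2; rewrite leq_exp2l //];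
  apply: leq_trans (horner_nat_mono _ hn).
  rewrite hornerM hornerM hornerM hornerD tpE bpE !hornerC -[(b + _).+1]addn1.
  exact: leqnn.
by rewrite hornerD hornerM bpE !hornerC.
Qed.
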